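(* Let $M_W,L_W\ge0$, $\rho>0$, $\delta\in(0,1]$ and $N\ge2$. Assume that $W$ is $(M_W,L_W)$-decomposable, that $m_*$ satisfies a $\rho$-Talagrand inequality, and that $\mathcal F(\nu|m_* )\ge\delta H(\nu|m_* )$ for all $\nu\in\mathcal P_2(\mathcal X)$. Put $\ell_W=L_W/\rho$. Then for all $\xi^1,\dots,\xi^N\in\mathcal P_2(\mathcal X)$, $$\mathcal F^N_{\mathrm{ind}}(\xi^1,\dots,\xi^N|m_* )\ge\delta_N\sum_{i\in[N]}H(\xi^i|m_* ),\qquad \delta_N=\delta-\frac{1+M_W+\ell_W}{N-1}.$$
   Context: $\mathcal X$ is either $\mathbb T^d$ (flat torus) or $\mathbb R^d$; $\mathcal P_2$ denotes probability measures with finite second moment (all probability measures on the torus). $\langle\cdot,\cdot\rangle$ is integration of a function against a (signed) measure; $[N]=\{1,\dots,N\}$. A kernel $U:\mathcal X\times\mathcal X\to\mathbb R$ is of quadratic growth if $|U(x,y)|\le C(1+|x|^2+|y|^2)$ (void on the torus). Setting: $V:\mathcal X\to\mathbb R$ and $W:\mathcal X\times\mathcal X\to\mathbb R$ are of class $C^2$, $W$ symmetric of quadratic growth. For $\nu\in\mathcal P_2(\mathcal X)$, $\Pi[\nu](dx)\propto\exp(-V(x)-\langle W(x,\cdot),\nu\rangle)\,dx$ (assumed normalizable), and $m_*\in\mathcal P_2(\mathcal X)$ is a fixed measure with $m_*=\Pi[m_*]$. $H(\nu|m)=\int\log\frac{d\nu}{dm}\,d\nu$ ($+\infty$ if $\nu\not\ll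 m$). Reduced kernel: $W_*(x,y)=W(x,y)-\langle W(x,\cdot),m_*\rangle-\langle W(\cdot,y),m_*\rangle+\langle W,m_*^{\otimes2}\rangle$. Functionals: $\mathcal F(\nu|m_* )=H(\nu|m_* )+\frac12\langle W_*,\nu^{\otimes2}\rangle$ and $\mathcal F^N_{\mathrm{ind}}(\xi^1,\dots,\xi^N|m_* )=\sum_{i\in[N]}H(\xi^i|m_* )+\frac1{2(N-1)}\sum_{i,j\in[N],\,i\ne j}\langle W_*,\xi^i\otimes\xi^j\rangle.$ A kernel $U$ of quadratic growth is positive if $\langle U,(\nu-\nu')^{\otimes2}\rangle\ge0$ for all $\nu,\nu'\in\mathcal P_2(\mathcal X)$. $\mathrm{Osc}_2U=\sup_{x,y,z,w}\langle U,(\delta_x-\delta_y)\otimes(\delta_z-\delta_w)\rangle$. $W$ is $(M_W,L_W)$-decomposable if $W=W^+-W^-$ with $W^\pm$ positive symmetric kernels of quadratic growth such that: if $\mathcal X=\mathbb T^d$, $\mathrm{Osc}_2W^++\mathrm{Osc}_2W^-\le4M_W$ and $L_W=0$; if $\mathcal X=\mathbb R^d$, $W^s=W^s_{b}+W^s_{q}$ for $s=+,-$ with symmetric kernels satisfying $\mathrm{Osc}_2W_b^++\mathrm{Osc}_2W_b^-\le4M_W$ and $\|\nabla^2_{1,2}W_q^+\|_{L^\infty}+\|\nabla^2_{1,2}W_q^-\|_{L^\infty}\le L_W$ ($\nabla_{1,2}^2$ is the mixed second derivative matrix, in operator norm). $m$ satisfies a $\rho$-Talagrand inequality if $H(\nu|m)\ge\frac\rho2\mathcal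 W_2^2(\nu,m)$ for all $\nu\in\mathcal P_2(\mathcal X)$, with $\mathcal W_2$ the quadratic Wasserstein distance. *)

(* Defs.v *)
From HB Require Import structures.
From mathcomp Require Import all_boot all_order all_algebra.
From mathcomp Require Import generic_quotient.
From mathcomp Require Import all_classical all_reals all_analysis.

Set Implicit Arguments.
Unset Strict Implicit.
Unset Printing Implicit Defensive.

Import Order.TTheory GRing.Theory Num.Theory.
Import numFieldNormedType.Exports.

Local Open Scope classical_set_scope.
Local Open Scope ring_scope.

(* The sigma-algebra generated by the coordinates is the Borel one. *)
Section measurable_rV.
Context (R : realType) (n : nat).

Let coors (i : 'I_n) (x : 'rV[R]_n) : R := x ord0 i.

Let rV_set0 : g_sigma_preimage coors set0.
Proof. exact: sigma_algebra0. Qed.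

Let rV_setC A : g_sigma_preimage coors A -> g_sigma_preimage coors (~` A).
Proof. exact: sigma_algebraC. Qed.

Let rV_bigcup (F : (set 'rV[R]_n)^nat) :
  (forall i, g_sigma_preimage coors (F i)) ->
  g_sigma_preimage coors (\bigcup_i (F i)).
Proof. exact: sigma_algebra_bigcup. Qed.

HB.instance Definition _ := @isMeasurable.Build default_measure_display
  'rV[R]_n (g_sigma_preimage coors) rV_set0 rV_setC rV_bigcup.

Lemma measurable_coord (i : 'I_n) :
  measurable_fun [set: 'rV[R]_n] (fun x => x ord0 i).
Proof.
move=> _ Y mY; rewrite setTI; apply: sub_sigma_algebra => /=.
rewrite -bigcup_seq/=; exists i => /=; first by rewrite mem_index_enum.
by exists Y => //; rewrite setTI.
Qed.

Lemma measurable_fun_coordP d (T : measurableType d) (f : T -> 'rV[R]_n) :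
  (forall i, measurable_fun [set: T] (fun t => f t ord0 i)) ->
  measurable_fun [set: T] f.
Proof.
move=> mf _ Y mY; rewrite setTI; move: mY.
rewrite /measurable/= => /(_ (image_set_system setT f measurable)).
suff H : image_set_system setT f measurable Y -> measurable (f @^-1` Y).
  move=> mY; apply: H; apply: mY; split.
    by apply: sigma_algebra_image; exact: sigma_algebra_measurable.
  move=> A /=; rewrite -bigcup_seq/= => -[i _ [B mB <-]].
  rewrite /image_set_system/= !setTI -comp_preimage.
  by rewrite -[X in measurable X]setTI; exact: mf.
by rewrite /image_set_system/= setTI.
Qed.

End measurable_rV.

Section lebesgue_rV.
Context {R : realType}.

Definition cons_rV n (p : measurableTypeR R * 'rV[R]_n) : 'rV[R]_n.+1 :=
  row_mx (const_mx p.1 : 'rV[R]_1) p.2.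

Definition uncons_rV n (x : 'rV[R]_n.+1) : measurableTypeR R * 'rV[R]_n :=
  (x ord0 ord0, @rsubmx R 1 1 n x).

Lemma cons_rVK n : cancel (@cons_rV n) (@uncons_rV n).
Proof.
move=> [t x]; rewrite /cons_rV /uncons_rV/= row_mxKr; congr pair.
have -> : ord0 = lshift n ord0 :> 'I_(1 + n) by apply/val_inj.
by rewrite (@row_mxEl _ 1 1 n) mxE.
Qed.

Lemma measurable_cons_rV n : measurable_fun setT (@cons_rV n).
Proof.
apply: measurable_fun_coordP => i; rewrite /cons_rV.
case: (splitP (i : 'I_(1 + n))) => j ij.
- have -> : i = lshift n j by apply/val_inj.
  rewrite (_ : (fun _ => _) = fst)//; apply/funext => p.
  by rewrite (@row_mxEl _ 1 1 n) mxE.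
- have -> : i = rshift 1 j by apply/val_inj.
  rewrite (_ : (fun _ => _) =
      (fun x : 'rV[R]_n => x ord0 j) \o snd); last first.
    by apply/funext => p; rewrite (@row_mxEr _ 1 1 n).
  by apply: measurableT_comp => //; exact: measurable_coord.
Qed.

Lemma measurable_uncons_rV n : measurable_fun setT (@uncons_rV n).
Proof.
apply: measurable_fun_pair; first exact: measurable_coord.
apply: measurable_fun_coordP => i.
rewrite (_ : (fun _ => _) = fun x : 'rV[R]_n.+1 => x ord0 (rshift 1 i)).
  exact: measurable_coord.
by apply/funext => x; rewrite mxE.
Qed.

Definition lebesgue_rVS n
    (mu : {sigma_finite_measure set 'rV[R]_n -> \bar R}) :=
  pushforward (@lebesgue_measure R \x mu)%E (@cons_rV n).

Section lebesgue_rVS_measure.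
Context n (mu : {sigma_finite_measure set 'rV[R]_n -> \bar R}).

Let mpre (A : set 'rV[R]_n.+1) : measurable A ->
  measurable (@cons_rV n @^-1` A).
Proof.
by move=> mA; rewrite -[X in measurable X]setTI; exact: measurable_cons_rV.
Qed.

Let S0 : lebesgue_rVS mu set0 = 0%E.
Proof. by rewrite /lebesgue_rVS /pushforward preimage_set0 measure0. Qed.

Let Sge0 A : (0 <= lebesgue_rVS mu A)%E.
Proof. by rewrite /lebesgue_rVS /pushforward; exact: measure_ge0. Qed.

Let Ssigma : semi_sigma_additive (lebesgue_rVS mu).
Proof.
move=> F mF tF mUF; rewrite /lebesgue_rVS /pushforward preimage_bigcup.
apply: measure_semi_sigma_additive => //.
- by move=> k; exact: mpre.
- apply/trivIsetP => /= i j _ _ ij; rewrite -preimage_setI.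
  by move/trivIsetP : tF => /(_ _ _ _ _ ij) ->//; rewrite preimage_set0.
- by rewrite -preimage_bigcup; exact: mpre.
Qed.

HB.instance Definition _ := isMeasure.Build _ _ _ (lebesgue_rVS mu)
  S0 Sge0 Ssigma.

Let Ssf : sigma_finite setT (lebesgue_rVS mu).
Proof.
have /sigma_finiteP[F [TF ndF Foo]] := sigma_finiteT (@lebesgue_measure R).
have /sigma_finiteP[G [TG ndG Goo]] := sigma_finiteT mu.
exists (fun k => @uncons_rV n @^-1` (F k `*` G k)).
  rewrite -preimage_bigcup.
  rewrite (_ : \bigcup_k (F k `*` G k) = setT) ?preimage_setT//.
  rewrite -subTset => -[x y] _.
  have [i _ Fix] : (\bigcup_k F k) x by rewrite -TF.
  have [j _ Gjy] : (\bigcup_k G k) y by rewrite -TG.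
  exists (maxn i j) => //; split.
  - by move: x Fix; exact/subsetPset/ndF/leq_maxl.
  - by move: y Gjy; exact/subsetPset/ndG/leq_maxr.
move=> k; have [mF Fk] := Foo k; have [mG Gk] := Goo k; split.
  rewrite -[X in measurable X]setTI; apply: measurable_uncons_rV => //.
  exact: measurableX.
rewrite /lebesgue_rVS /pushforward -comp_preimage.
have -> : @uncons_rV n \o @cons_rV n = id by apply/funext; exact: cons_rVK.
by rewrite preimage_id product_measure1E// lte_mul_pinfty// ge0_fin_numE.
Qed.

HB.instance Definition _ := Measure_isSigmaFinite.Build _ _ _ (lebesgue_rVS mu)
  Ssf.

End lebesgue_rVS_measure.

(* Lebesgue measure on R^n: the product of one-dimensional ones. *)
Fixpoint lebesgue_rV n : {sigma_finite_measure set 'rV[R]_n -> \bar R} :=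
  if n is n'.+1 then lebesgue_rVS (lebesgue_rV n')
  else \d_(0 : 'rV[R]_0).

End lebesgue_rV.

(* The flat torus R^d / Z^d, with the quotient sigma-algebra (a set is
   measurable iff its Z^d-periodic lift is Borel), which is the Borel
   sigma-algebra of the quotient topology. *)
Section torus.
Context (R : realType) (d : nat).

Definition congZ (x y : 'rV[R]_d) : bool :=
  [forall i, x ord0 i - y ord0 i \is a Num.int].

Lemma congZ_equiv : equiv_class_of congZ.
Proof.
split=> [x|x y|y x z].
- by apply/forallP => i; rewrite subrr rpred0.
- by apply/forallP/forallP => H i; rewrite -opprB rpredN.
- move=> /forallP xy /forallP yz; apply/forallP => i.
  by rewrite -(subrK (y ord0 i) (x ord0 i)) -addrA rpredD.
Qed.

Canonical congZ_equiv_rel := EquivRelPack congZ_equiv.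

Definition torus : Type := {eq_quot congZ}%qT.

HB.instance Definition _ := Choice.on torus.

Definition torus_proj (x : 'rV[R]_d) : torus := (\pi_({eq_quot congZ}) x)%qT.

HB.instance Definition _ := isPointed.Build torus (torus_proj 0).

Let torus_meas := image_set_system setT torus_proj (@measurable _ 'rV[R]_d).

Let torus_sigma : sigma_algebra setT torus_meas.
Proof. by apply: sigma_algebra_image; exact: sigma_algebra_measurable. Qed.

Let torus0 : torus_meas set0.
Proof. by case: torus_sigma. Qed.

Let torusC A : torus_meas A -> torus_meas (~` A).
Proof. by case: torus_sigma => _ + _ mA => /(_ A mA); rewrite setTD. Qed.

Let torusU (F : (set torus)^nat) : (forall i, torus_meas (F i)) ->
  torus_meas (\bigcup_i F i).
Proof. by case: torus_sigma => _ _ + mF; apply. Qed.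

HB.instance Definition _ := @isMeasurable.Build default_measure_display
  torus torus_meas torus0 torusC torusU.

End torus.

Variant geometry := Torus | Euclidean.

Definition state_space (R : realType) (g : geometry) (d : nat) :
    measurableType default_measure_display :=
  match g with Torus => torus R d | Euclidean => 'rV[R]_d end.

Definition covering_map {R : realType} (g : geometry) {d : nat} :
    'rV[R]_d -> state_space R g d :=
  match g with Torus => @torus_proj R d | Euclidean => id end.

Definition fundamental_domain {R : realType} (g : geometry) {d : nat} :
    set 'rV[R]_d :=
  match g with
  | Torus => [set x | forall i, 0 <= x ord0 i < 1]
  | Euclidean => setT
  end.

(* The library norm on 'rV[R]_d is the sup norm. *)
Definition euclidean_norm {R : realType} {d : nat} (x : 'rV[R]_d) : R :=
  Num.sqrt (\sum_i x ord0 i ^+ 2).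

Definition dist {R : realType} {g : geometry} {d : nat} :
    state_space R g d -> state_space R g d -> R :=
  match g with
  | Torus => fun a b =>
      inf [set r | exists x y, [/\ torus_proj x = a, torus_proj y = b &
                                   r = euclidean_norm (x - y)]]
  | Euclidean => fun x y => euclidean_norm (x - y)
  end.

Definition P2 {R : realType} {g : geometry} {d : nat} :
    probability (state_space R g d) R -> Prop :=
  match g with
  | Torus => fun _ => True
  | Euclidean => fun nu => (\int[nu]_x (euclidean_norm x ^+ 2)%:E < +oo)%E
  end.

Section smoothness.
Context {R : realType}.

Definition class_C1 (E : normedModType R) (f : E -> R) : Prop :=
  (forall x, differentiable f x) /\ forall v, continuous ('D_v f).

Definition class_C2 (E : normedModType R) (f : E -> R) : Prop :=
  (forall x, differentiable f x) /\ forall v, class_C1 ('D_v f).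

Context {g : geometry} {d : nat}.

(* On the torus, a function is C^2 iff its periodic lift is. *)
Definition C2_fun (V : state_space R g d -> R) : Prop :=
  class_C2 (V \o covering_map g).

Definition C2_kernel (W : state_space R g d -> state_space R g d -> R) : Prop :=
  class_C2 (fun z : 'rV[R]_d * 'rV[R]_d =>
    W (covering_map g z.1) (covering_map g z.2)).

End smoothness.

Section kernels.
Context {R : realType} {g : geometry} {d : nat}.
Local Notation X := (state_space R g d).
Implicit Types (U W : X -> X -> R) (mu nu : probability X R).

Definition borel_kernel U : Prop :=
  measurable_fun [set: X * X] (fun z => U z.1 z.2).

Definition symmetric_kernel U : Prop := forall x y, U x y = U y x.

Definition pairing U mu nu : R := \int[(mu \x nu)%E]_z U z.1 z.2.

(* <U, (nu - nu') (x) (nu - nu')> *)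
Definition pairing_diff U nu nu' : R :=
  pairing U nu nu - pairing U nu nu' - pairing U nu' nu + pairing U nu' nu'.

(* Positivity presupposes that the pairings make sense.  Integrability is
   automatic for a Borel kernel of quadratic growth on R^d; on the torus, where
   no growth is imposed, it amounts to boundedness. *)
Definition positive_kernel U : Prop :=
  (forall mu nu, P2 mu -> P2 nu ->
     (mu \x nu)%E.-integrable [set: X * X] (fun z => (U z.1 z.2)%:E)) /\
  (forall nu nu', P2 nu -> P2 nu' -> 0 <= pairing_diff U nu nu').

Definition Osc2 U : \bar R :=
  ereal_sup [set r | exists x y z w,
                       r = (U x z - U x w - U y z + U y w)%:E].

Definition reduced W (m : probability X R) (x y : X) : R :=
  W x y - (\int[m]_y' W x y') - (\int[m]_x' W x' y) + pairing W m m.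

End kernels.

Definition quadratic_growth {R : realType} {g : geometry} {d : nat} :
    (state_space R g d -> state_space R g d -> R) -> Prop :=
  match g with
  | Torus => fun _ => True
  | Euclidean => fun U => exists C : R, forall x y,
      `|U x y| <= C * (1 + euclidean_norm x ^+ 2 + euclidean_norm y ^+ 2)
  end.

Section mixed_hessian.
Context {R : realType} {d : nat}.
Implicit Types U : 'rV[R]_d -> 'rV[R]_d -> R.

(* Classical existence of the mixed Hessian; implied by C^2. *)
Definition mixed_differentiable U : Prop :=
  (forall x y, differentiable (U x) y) /\
  (forall y v x, differentiable (fun x' => 'D_v (U x') y) x).

Definition mixed_hessian U (x y : 'rV[R]_d) : 'M[R]_d :=
  \matrix_(i, j) 'D_(delta_mx ord0 i)
    (fun x' => 'D_(delta_mx ord0 j) (U x') y) x.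

Definition operator_norm (A : 'M[R]_d) : \bar R :=
  ereal_sup [set (euclidean_norm (v *m A))%:E |
             v in [set v : 'rV[R]_d | euclidean_norm v <= 1]].

(* The L^oo norm is the supremum over all points, which for a continuous
   Hessian is also the essential supremum. *)
Definition mixed_hessian_norm U : \bar R :=
  ereal_sup [set operator_norm (mixed_hessian U z.1 z.2) | z in setT].

End mixed_hessian.

Section decomposable.
Context {R : realType}.

Definition decomposition_bounds {g : geometry} {d : nat} :
    (state_space R g d -> state_space R g d -> R) ->
    (state_space R g d -> state_space R g d -> R) -> R -> R -> Prop :=
  match g with
  | Torus => fun Wp Wm M L =>
      (Osc2 Wp + Osc2 Wm <= (4 * M)%:E)%E /\ L = 0
  | Euclidean => fun Wp Wm M L =>
      exists Wpb Wpq Wmb Wmq :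
        state_space R Euclidean d -> state_space R Euclidean d -> R,
      let K U := borel_kernel U /\ symmetric_kernel U in
      [/\ forall x y, Wp x y = Wpb x y + Wpq x y /\
                      Wm x y = Wmb x y + Wmq x y,
          [/\ K Wpb, K Wpq, K Wmb & K Wmq],
          mixed_differentiable Wpq /\ mixed_differentiable Wmq,
          (Osc2 Wpb + Osc2 Wmb <= (4 * M)%:E)%E &
          (mixed_hessian_norm Wpq + mixed_hessian_norm Wmq <= L%:E)%E]
  end.

Context {g : geometry} {d : nat}.

Definition decomposable (W : state_space R g d -> state_space R g d -> R)
    (M L : R) : Prop :=
  exists Wp Wm : state_space R g d -> state_space R g d -> R,
    let K U := [/\ borel_kernel U, symmetric_kernel U,
                   quadratic_growth U & positive_kernel U] in
    [/\ forall x y, W x y = Wp x y - Wm x y,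
        K Wp, K Wm & decomposition_bounds Wp Wm M L].

End decomposable.

Section measures.
Context {R : realType} {g : geometry} {d : nat}.
Local Notation X := (state_space R g d).
Implicit Types (V : X -> R) (W : X -> X -> R) (m nu : probability X R).

Local Open Scope ereal_scope.

(* Integrals against dx on the torus are over a fundamental domain. *)
Definition gibbs_mass V W nu (A : set X) : \bar R :=
  \int[@lebesgue_rV R d]_(x in fundamental_domain g `&` covering_map g @^-1` A)
    (expR (- V (covering_map g x) - \int[nu]_y W (covering_map g x) y))%R%:E.

Definition normalizable V W nu : Prop := gibbs_mass V W nu setT < +oo.

Definition Pi V W nu (A : set X) : \bar R :=
  (fine (gibbs_mass V W nu setT))^-1%:E * gibbs_mass V W nu A.

Definition is_Pi V W (m nu : probability X R) : Prop :=
  forall A, measurable A -> m A = Pi V W nu A.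

Definition entropy nu m : \bar R :=
  if `[< nu `<< m >] then
    \int[nu]_x (ln (fine (Radon_Nikodym (charge_of_finite_measure nu) m x)))%:E
  else +oo.

Definition free_energy W m nu : \bar R :=
  entropy nu m + (2^-1 * pairing (reduced W m) nu nu)%:E.

Definition free_energy_ind W m N (xi : 'I_N -> probability X R) : \bar R :=
  \sum_(i < N) entropy (xi i) m +
  ((2 * (N%:R - 1))^-1 *
   \sum_(i < N) \sum_(j < N | j != i) pairing (reduced W m) (xi i) (xi j))%R%:E.

Definition coupling nu m (pi : probability (X * X)%type R) : Prop :=
  forall A, measurable A -> pi (fst @^-1` A) = nu A /\ pi (snd @^-1` A) = m A.

Definition W2 nu m : \bar R :=
  ereal_inf [set \int[pi]_z (dist z.1 z.2 ^+ 2)%:E |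
             pi in [set pi | coupling nu m pi]] `^ 2^-1.

Definition talagrand (rho : R) m : Prop :=
  forall nu, P2 nu -> (rho / 2)%:E * W2 nu m ^+ 2 <= entropy nu m.

End measures.

(* Main.v *)
From HB Require Import structures.
Require Import Defs.
From mathcomp Require Import all_boot all_order all_algebra.
From mathcomp Require Import all_classical all_reals all_analysis.
From mathcomp Require Import measurable_realfun ring lra.

Set Implicit Arguments.
Unset Strict Implicit.
Unset Printing Implicit Defensive.

Import Order.TTheory GRing.Theory Num.Theory.
Import numFieldNormedType.Exports.

Local Open Scope classical_set_scope.
Local Open Scope ring_scope.

(* Let [xibar] be the mean of the measures [xi i].  The off-diagonal sum in
   the free energy of [xi] is [N ^ 2 <W_*, xibar (x) xibar>] minus the diagonal
   terms.  The former is bounded below by the hypothesis at [xibar] and convexity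
   of the entropy.  Each diagonal term is [<W, (xi i - m) (x) (xi i - m)>], at most
   the same expression for [W^+] by positivity of [W^-].  For [W^+] one only needs
   the increment of [xi i - m] against functions that are Lipschitz for a given
   (pseudo-)distance, once in each variable: Pinsker's inequality controls it for
   functions of bounded oscillation, Talagrand's for Euclidean Lipschitz
   functions, and both bounds are of order the square root of the entropy. *)

(** * Convexity of the entropy integrand, Pinsker's inequality for real numbers, and a square-root
    optimisation *)

Section real_inequalities.
Context {R : realType}.
Implicit Types (s t a b x y K : R).

(** The entropy integrand [t * ln t], corrected by [1 - t]. The correction has integral zero along a
    probability density and makes the integrand nonnegative. *)
Definition ent t := t * ln t - t + 1.

(** Convexity: [ln s] is the derivative of [ent] at [s]. For [t > 0] this is [ln x <= x - 1] at
    [x = s / t], multiplied by [t]; for [t = 0] it reads [1 - s <= 1]. *)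
Lemma ent_tangent s t : 0 < s -> 0 <= t -> ent s + ln s * (t - s) <= ent t.
Proof.
move=> s0; rewrite le_eqVlt => /predU1P[<-|t0]; rewrite /ent.
  by rewrite mul0r; nra.
have st : 0 < s / t by rewrite divr_gt0.
have h : ln s - ln t <= s / t - 1.
  rewrite -ln_div ?posrE//; move: (s / t) st => x x0.
  by have := @le_ln1Dx R (x - 1); rewrite (addrC 1) subrK; apply; lra.
have : t * (ln s - ln t) <= t * (s / t - 1) by apply: ler_wpM2l => //; exact: ltW.
have -> : t * (s / t - 1) = s - t by field; rewrite gt_eqF.
lra.
Qed.

Lemma ent_ge0 t : 0 <= t -> 0 <= ent t.
Proof.
move=> /(ent_tangent ltr01); apply: le_trans.
by rewrite /ent ln1; lra.
Qed.

(** Summing the tangent inequalities at the mean [s] cancels the linear terms. There is no tangent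
    at [s = 0], but then every [t i] vanishes. *)
Lemma ent_jensen n (t : 'I_n.+1 -> R) : (forall i, 0 <= t i) ->
  ent (n.+1%:R^-1 * \sum_i t i) <= n.+1%:R^-1 * \sum_i ent (t i).
Proof.
move=> t0; set s := _ * _.
have n0 : (0 : R) < n.+1%:R by rewrite ltr0n.
have s0 : 0 <= s by apply: mulr_ge0; [rewrite invr_ge0 ltW|exact: sumr_ge0].
have sE : \sum_i t i = n.+1%:R * s by rewrite /s mulrA divff ?mul1r// gt_eqF.
rewrite mulrC ler_pdivlMr//; move: s0; rewrite le_eqVlt => /predU1P[s0|s0].
  have ti i : t i = 0.
    apply/eqP; move: i; apply/forallP.
    have := sE; rewrite -s0 mulr0 => /eqP.
    rewrite psumr_eq0// => /allP H; apply/forallP => i.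
    by apply: H; rewrite mem_index_enum.
  rewrite -s0 (eq_bigr (fun=> ent 0)) => [|i _]; last by rewrite ti.
  by rewrite sumr_const card_ord mulr_natr.
apply: (@le_trans _ _ (\sum_i (ent s + ln s * (t i - s)))).
  rewrite big_split/= sumr_const card_ord -mulr_sumr sumrB sE sumr_const.
  by rewrite card_ord -(mulr_natl s) subrr mulr0 addr0 mulr_natr.
by apply: ler_sum => i _; exact: ent_tangent.
Qed.

(** What remains of [(2 * t + 4) * ent t - 3 * (t - 1) ^+ 2] after division by [(2 * t + 4) * t];
    isolating the logarithm makes the derivative rational. *)
Let pade t := ln t - (t - 1) * (5 * t + 1) / (2 * t * (t + 2)).

Let is_derive_pade t : 0 < t ->
  is_derive t 1 pade ((t - 1) ^+ 3 / (t ^+ 2 * (t + 2) ^+ 2)).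
Proof.
move=> t0; rewrite /pade.
have t2 : 2 * t * (t + 2) != 0 by rewrite !mulf_neq0//; lra.
have := is_derive1_ln t0 => dln.
have dinv := @is_deriveV R (fun t => 2 * t * (t + 2)) t _ 1 t2 _.
apply: is_derive_eq.
rewrite /GRing.scale/=.
field.
by apply/andP; split; lra.
Qed.

(* The difference of the two sides of the logarithmic form
   [ln t - (t - 1)(5t + 1) / (2t(t + 2))] has derivative
   [(t - 1)^3 / (t^2 (t + 2)^2)]. *)
Lemma pinsker_pointwise t : 0 <= t ->
  3 * (t - 1) ^+ 2 <= (2 * t + 4) * ent t.
Proof.
have pade1 : pade 1 = 0 by rewrite /pade ln1 subrr !mul0r subr0.
have cpade a b : 0 < a -> {within `[a, b], continuous pade}.
  move=> a0; apply: derivable_within_continuous => x.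
  rewrite in_itv/= => /andP[ax _].
  by have [] := is_derive_pade (lt_le_trans a0 ax).
have dpade a b : 0 < a -> forall x, x \in `]a, b[ -> is_derive x 1 pade
    ((x - 1) ^+ 3 / (x ^+ 2 * (x + 2) ^+ 2)).
  by move=> a0 x; rewrite in_itv/= => /andP[ax _]; exact/is_derive_pade/(lt_trans a0).
rewrite le_eqVlt => /predU1P[<-|t0]; first by rewrite /ent; lra.
suff pt : 0 <= pade t.
  have -> : (2 * t + 4) * ent t =
      3 * (t - 1) ^+ 2 + (2 * t + 4) * t * pade t.
    by rewrite /pade /ent; field; apply/andP; split; lra.
  by rewrite lerDl; apply: mulr_ge0 => //; nra.
have den (c : R) : 0 < c -> 0 < c ^+ 2 * (c + 2) ^+ 2.
  by move=> c0; rewrite mulr_gt0 ?exprn_gt0//; lra.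
have [t1|t1|->] := ltgtP t 1; last by rewrite pade1.
- have [c] := MVT t1 (dpade _ _ t0) (cpade _ _ t0).
  rewrite in_itv/= pade1 sub0r => /andP[tc c1] e.
  rewrite -oppr_le0 e pmulr_lle0 ?subr_gt0//.
  rewrite pmulr_lle0 ?invr_gt0 ?den//; last lra.
  by rewrite exprS; have := sqr_ge0 (c - 1); nra.
- have [c] := MVT t1 (dpade _ _ ltr01) (cpade _ _ ltr01).
  rewrite in_itv/= pade1 subr0 => /andP[tc c1] ->.
  rewrite mulr_ge0 ?subr_ge0 ?ltW//.
  by rewrite divr_gt0 ?den ?exprn_gt0//; lra.
Qed.

(** For [b > 0] the minimum over [a] is at [a = Num.sqrt b]; for [b = 0] it is only approached as
    [a] tends to 0. Square-root bounds thus follow from integrating pointwise bounds that depend on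
    a parameter [a]. *)
Lemma am_gm_sqrt x K b : 0 <= K -> 0 <= b ->
  (forall a, 0 < a -> x <= K / 2 * (a + b / a)) -> x <= K * Num.sqrt b.
Proof.
move=> K0; rewrite le_eqVlt => /predU1P[<-|b0] H.
  rewrite sqrtr0 mulr0; apply/ler_addgt0Pl => e e0.
  have K1 : 0 < K + 1 by lra.
  (* The added 1 keeps the denominator positive when [K = 0]. *)
  have := H (e / (K + 1)) (divr_gt0 e0 K1); rewrite mul0r addr0 => /le_trans; apply.
  rewrite addr0 [leLHS](_ : _ = e * (K / (2 * (K + 1)))); last by field; lra.
  apply: ler_piMr; first exact: ltW.
  by rewrite ler_pdivrMr; lra.
have sb : 0 < Num.sqrt b by rewrite sqrtr_gt0.
apply: (le_trans (H _ sb)).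
rewrite -{2}(sqr_sqrtr (ltW b0)) expr2 mulfK ?gt_eqF//; lra.
Qed.

End real_inequalities.

(** * Linear operations on integrable real functions *)

Section real_integrability.
Context d (T : measurableType d) (R : realType) (mu : {measure set T -> \bar R}).
Implicit Types f g : T -> R.

Lemma integrableD_EFin f g : mu.-integrable setT (EFin \o f) ->
  mu.-integrable setT (EFin \o g) ->
  mu.-integrable setT (EFin \o (fun x => f x + g x)).
Proof. by move=> fi gi; exact: (integrableD measurableT fi gi). Qed.

Lemma integrableB_EFin f g : mu.-integrable setT (EFin \o f) ->
  mu.-integrable setT (EFin \o g) ->
  mu.-integrable setT (EFin \o (fun x => f x - g x)).
Proof. by move=> fi gi; exact: (integrableB measurableT fi gi). Qed.

Lemma integrableZ_EFin (c : R) f : mu.-integrable setT (EFin \o f) ->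
  mu.-integrable setT (EFin \o (fun x => c * f x)).
Proof. by move=> fi; exact: (integrableZl measurableT c fi). Qed.

End real_integrability.

Lemma Rintegral_probability_cst d (T : measurableType d) (R : realType)
    (P : probability T R) (c : R) : \int[P]_x c = c.
Proof. by rewrite Rintegral_cst//= (@probability_setT _ _ _ P) mulr1. Qed.

(** * Relative entropy in terms of a density, and Pinsker's inequality *)

Section relative_entropy.
Context {R : realType} {g : geometry} {d : nat}.
Local Notation X := (state_space R g d).
Implicit Types (m nu : probability X R) (f k : X -> R).

Local Open Scope ereal_scope.

(** A version of the density that is real and nonnegative at every point, whereas the Radon-Nikodym
    derivative is determined only almost everywhere. *)
Definition is_density nu m f := [/\ measurable_fun setT f,
  forall x, (0 <= f x)%R &
  forall A, measurable A -> nu A = \int[m]_(x in A) (f x)%:E].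

Lemma density_dominates nu m f : is_density nu m f -> nu `<< m.
Proof.
move=> [mf f0 fE]; apply/null_content_dominatesP => A mA mA0.
rewrite fE//; apply: null_set_integral => //.
by apply/measurable_EFinP; exact: measurable_funTS.
Qed.

Lemma dominates_density nu m : nu `<< m -> exists f, is_density nu m f.
Proof.
move=> num; pose f := Radon_Nikodym_SigmaFinite.f nu m.
have ff x : (fine (f x))%:E = f x.
  by rewrite fineK// Radon_Nikodym_SigmaFinite.f_fin_num.
exists (fine \o f); split.
- apply: measurableT_comp => //.
  exact/(measurable_int m)/Radon_Nikodym_SigmaFinite.f_integrable.
- by move=> x; rewrite fine_ge0// Radon_Nikodym_SigmaFinite.f_ge0.
- move=> A mA; rewrite (Radon_Nikodym_SigmaFinite.f_integral num)//.
  by apply: eq_integral => x _ /=; rewrite ff.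
Qed.

Lemma density_integral1 nu m f : is_density nu m f ->
  \int[m]_x (f x)%:E = 1.
Proof. by move=> [_ _ <-//]; rewrite probability_setT. Qed.

Lemma density_integrable nu m f : is_density nu m f ->
  m.-integrable setT (EFin \o f).
Proof.
move=> fd; have [mf f0 _] := fd; apply/integrableP; split.
  exact/measurable_EFinP.
under eq_integral do rewrite gee0_abs ?lee_fin//.
by rewrite (density_integral1 fd) ltry.
Qed.

Lemma density_ae_eq nu m f : is_density nu m f ->
  ae_eq m setT (Radon_Nikodym_SigmaFinite.f nu m) (EFin \o f).
Proof.
move=> fd; have num := density_dominates fd; have [mf f0 fE] := fd.
apply: integral_ae_eq => //.
- exact: Radon_Nikodym_SigmaFinite.f_integrable.
- exact/measurable_EFinP.
- move=> A _ mA; apply: etrans (fE _ mA).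
  exact/esym/Radon_Nikodym_SigmaFinite.f_integral.
Qed.

Lemma density_ge0_integral nu m f (k : X -> \bar R) : is_density nu m f ->
  measurable_fun setT k -> (forall x, 0 <= k x) ->
  \int[nu]_x k x = \int[m]_x (k x * (f x)%:E).
Proof.
move=> fd mk k0; have num := density_dominates fd; have [mf f0 fE] := fd.
rewrite -(Radon_Nikodym_SigmaFinite.change_of_variables num)//.
have mRN : measurable_fun setT (Radon_Nikodym_SigmaFinite.f nu m).
  exact/(measurable_int m)/Radon_Nikodym_SigmaFinite.f_integrable.
apply: ae_eq_integral => //; [exact: emeasurable_funM| |].
- by apply: emeasurable_funM => //; exact/measurable_EFinP.
- exact/ae_eqe_mul2l/density_ae_eq.
Qed.

Lemma density_integrableM nu m f k : is_density nu m f ->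
  nu.-integrable setT (EFin \o k) ->
  m.-integrable setT (EFin \o (fun x => k x * f x)%R).
Proof.
move=> fd ik; have [mf f0 fE] := fd.
have mk : measurable_fun setT k by exact/measurable_EFinP/(measurable_int nu).
move/integrableP: ik => [_ ik]; apply/integrableP; split.
  by apply/measurable_EFinP; exact: measurable_funM.
under eq_integral => x _.
  rewrite /= normrM (ger0_norm (f0 x)) EFinM -[(`|k x|%R)%:E]/(`|(k x)%:E|); over.
rewrite -(density_ge0_integral fd)//.
by apply: measurableT_comp => //; exact/measurable_EFinP.
Qed.

Lemma density_Rintegral nu m f k : is_density nu m f ->
  nu.-integrable setT (EFin \o k) ->
  (\int[nu]_x k x = \int[m]_x (k x * f x))%R.
Proof.
move=> fd ik; have [mf f0 fE] := fd; have num := density_dominates fd.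
rewrite /Rintegral; congr fine.
have mk : measurable_fun setT (EFin \o k) by exact: (measurable_int nu).
(* Multiplication by the nonnegative [f] commutes with taking positive and negative parts. *)
rewrite integralE (density_ge0_integral fd)//; last exact: measurable_funepos.
rewrite (density_ge0_integral fd)//; last exact: measurable_funeneg.
rewrite [RHS]integralE; congr (_ - _); apply: eq_integral => x _.
  by rewrite !funeposE /= EFinM maxe_pMl ?lee_fin// mul0e.
by rewrite !funenegE EFinM -mulNe maxe_pMl ?lee_fin// mul0e.
Qed.

Lemma measurable_ent : measurable_fun [set: R] (@ent R).
Proof.
apply: measurable_funD => //; apply: measurable_funB => //.
by apply: measurable_funM => //; exact: measurable_ln.
Qed.

(** The terms [- f] and [+ 1] of [ent] cancel after integration. As the entropy may be infinite,
    [f * ln f] is split into its parts [p] and [q], and only [q] is known to have a finite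
    integral. *)
Lemma entropyE nu m f : is_density nu m f ->
  entropy nu m = \int[m]_x (ent (f x))%:E.
Proof.
move=> fd; have [mf f0 fE] := fd; have num := density_dominates fd.
have mlnf : measurable_fun setT (fun x => (ln (f x))%:E).
  apply/measurable_EFinP.
  exact: (measurableT_comp (@measurable_ln R) mf).
have mlf : measurable_fun setT (fun x => f x * ln (f x))%R.
  by apply: measurable_funM => //; exact/measurable_EFinP.
have ment : measurable_fun setT (fun x => (ent (f x))%:E).
  by apply/measurable_EFinP; exact: (measurableT_comp measurable_ent mf).
rewrite /entropy asboolT//.
rewrite (ae_eq_integral (fun x => (ln (f x))%:E))//; last 2 first.
- apply/measurable_EFinP; apply: (measurableT_comp (@measurable_ln R)).
  by apply: measurableT_comp.
- apply: (null_dominates_ae_eq _ num) => //.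
  have RNE := ae_eq_Radon_Nikodym_SigmaFinite num measurableT.
  have := ae_eq_trans (ae_eq_sym RNE) (density_ae_eq fd).
  by apply: filterS => x /= /(_ I) -> _.
pose p x := (Num.max (f x * ln (f x)) 0)%R.
pose q x := (Num.max (- (f x * ln (f x))) 0)%R.
have p0 x : (0 <= p x)%R by rewrite le_max lexx orbT.
have q0 x : (0 <= q x)%R by rewrite le_max lexx orbT.
have mp : measurable_fun setT (EFin \o p).
  by apply/measurable_EFinP; exact: measurable_maxr.
have mq : measurable_fun setT (EFin \o q).
  by apply/measurable_EFinP; apply: measurable_maxr => //; exact: measurableT_comp.
have e0 x : (0 <= ent (f x))%R by exact: ent_ge0.
(* Nonnegativity of [ent] gives [- (f x * ln (f x)) <= 1 - f x]. *)
have q1 x : (q x <= 1)%R.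
  by rewrite ge_max ler01 andbT; have := e0 x; have := f0 x; rewrite /ent; lra.
have qfin : \int[m]_x (q x)%:E \is a fin_num.
  apply: integrable_fin_num => //.
  apply: (@le_integrable _ _ _ _ _ _ _ (EFin \o cst 1%R)) => //.
  - by move=> x _ /=; rewrite lee_fin !ger0_norm.
  - exact: finite_measure_integrable_cst.
rewrite integralE (density_ge0_integral fd)//; last exact: measurable_funepos.
rewrite (density_ge0_integral fd)//; last exact: measurable_funeneg.
rewrite (_ : \int[m]_x _ = \int[m]_x (p x)%:E); last first.
  apply: eq_integral => x _; rewrite funeposE maxe_pMl ?lee_fin// mul0e.
  by rewrite /p mulrC EFin_max.
rewrite (_ : \int[m]_x (_ * _) = \int[m]_x (q x)%:E); last first.
  apply: eq_integral => x _; rewrite funenegE maxe_pMl ?lee_fin// mul0e.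
  by rewrite /q mulrC EFin_max -EFinM mulNr.
(* All terms are nonnegative on both sides, so the integrals split even when some are infinite. *)
have : \int[m]_x ((ent (f x))%:E + ((q x)%:E + (f x)%:E)) =
       \int[m]_x ((p x)%:E + 1).
  apply: eq_integral => x _; rewrite -!EFinD; congr EFin; rewrite /p /q /ent.
  by case: (lerP (f x * ln (f x)) 0); case: (lerP (- (f x * ln (f x))) 0); lra.
have ge0E (u : X -> R) : (forall x, 0 <= u x)%R ->
    forall x, [set: X] x -> 0 <= (u x)%:E.
  by move=> u0 x _; rewrite lee_fin.
have pE0 := ge0E _ p0; have qE0 := ge0E _ q0; have fE0 := ge0E _ f0.
have eE0 := ge0E _ e0.
rewrite ge0_integralD//; last 2 first.
- by move=> x _; rewrite -EFinD lee_fin addr_ge0.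
- by apply: emeasurable_funD => //; exact/measurable_EFinP.
rewrite ge0_integralD//; last exact/measurable_EFinP.
rewrite ge0_integralD//.
have -> : \int[m]_x 1 = 1.
  by rewrite (integral_cst m measurableT 1) mul1e; exact: probability_setT.
rewrite (density_integral1 fd) -(fineK qfin).
move: (\int[m]_x (ent (f x))%:E) (\int[m]_x (p x)%:E) => [a||] [b||]//=.
by move=> [] h; rewrite -EFinB; congr EFin; lra.
Qed.

Lemma entropy_ge0 nu m : 0 <= entropy nu m.
Proof.
have [num|num] := pselect (nu `<< m); last by rewrite /entropy asboolF.
have [f fd] := dominates_density num; rewrite (entropyE fd).
by apply: integral_ge0 => x _; rewrite lee_fin; apply: ent_ge0; case: fd.
Qed.

Lemma finite_entropy_density nu m : entropy nu m < +oo ->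
  exists f, is_density nu m f.
Proof.
have [/dominates_density//|num] := pselect (nu `<< m).
by rewrite /entropy asboolF.
Qed.

Lemma finite_entropy_integrable nu m f : is_density nu m f ->
  entropy nu m < +oo -> m.-integrable setT (fun x => (ent (f x))%:E).
Proof.
move=> fd; rewrite (entropyE fd) => fin; have [mf f0 _] := fd.
apply/integrableP; split.
  by apply/measurable_EFinP; exact: (measurableT_comp measurable_ent mf).
by under eq_integral do rewrite gee0_abs ?lee_fin ?ent_ge0//.
Qed.

Lemma oscillation_integrable nu k (K : R) : measurable_fun setT k ->
  (forall x y, k x - k y <= K)%R -> nu.-integrable setT (EFin \o k).
Proof.
move=> mk kK.
apply: (@le_integrable _ _ _ _ _ _ _ (EFin \o cst (`|k point| + K)%R)) => //.
- exact/measurable_EFinP.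
- move=> x _ /=; rewrite lee_fin; apply: le_trans (ler_norm _).
  have := kK x point; have := kK point x.
  by rewrite ler_norml; case: (ler0P (k point)); lra.
- exact: finite_measure_integrable_cst.
Qed.

(** As [f - 1] has integral zero, [k] may be centred so that its absolute value is at most [K / 2].
    It remains to integrate a bound on [|f - 1|], where Cauchy-Schwarz is replaced by the
    arithmetic-geometric inequality with a parameter [a], optimised by [am_gm_sqrt]. *)
Lemma pinsker nu m k (K : R) : entropy nu m < +oo -> measurable_fun setT k ->
  (forall x y, k x - k y <= K)%R ->
  (\int[nu]_x k x - \int[m]_x k x <= K * Num.sqrt (fine (entropy nu m) / 2))%R.
Proof.
move=> fin mk kK; have [f fd] := finite_entropy_density fin.
have [mf f0 _] := fd; have iE := finite_entropy_integrable fd fin.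
have ik mu := oscillation_integrable mu mk kK.
have K0 : (0 <= K)%R by have := kK point point; rewrite subrr.
pose c := (inf (range k) + K / 2)%R.
have hinf : has_inf (range k).
  split; first by exists (k point); exists point.
  by exists (k point - K)%R => _ [x _ <-]; have := kK point x; lra.
have kc x : (`|k x - c| <= K / 2)%R.
  rewrite ler_norml /c; have : (inf (range k) <= k x)%R.
    by apply: ge_inf; [exact: hinf.2|exists x].
  have : (k x - K <= inf (range k))%R.
    by apply: lb_le_inf; [exact: hinf.1|move=> _ [y _ <-]; have := kK x y; lra].
  by lra.
rewrite (density_Rintegral fd (ik nu)).
apply: am_gm_sqrt => //; first by rewrite divr_ge0// fine_ge0// entropy_ge0.
move=> a a0.
(* The bracket on the right is the arithmetic mean of [a * (2 * f x + 4) / 3] and [ent (f x) / a],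
   whose product is at least [(f x - 1) ^+ 2] by [pinsker_pointwise]. Its integral is
   [a + H / (2 * a)], where [H] is the entropy, because [(2 * f + 4) / 3] has mean 2. *)
have pt x : (k x * f x - k x - c * (f x - 1) <=
    K / 2 * (a / 3 * f x + (2 * a / 3 + (2 * a)^-1 * ent (f x))))%R.
  have -> : (k x * f x - k x - c * (f x - 1) = (k x - c) * (f x - 1))%R by ring.
  apply: (le_trans (ler_norm _)); rewrite normrM ler_pM//.
  set w := (X in (_ <= X)%R).
  have w0 : (0 <= w)%R.
    have := f0 x; have := ent_ge0 (f0 x) => e0 fx0.
    by rewrite addr_ge0 ?addr_ge0 ?mulr_ge0 ?invr_ge0 ?divr_ge0//; lra.
  rewrite -(ler_pXn2r (n:=2)) ?nnegrE// real_normK ?num_real//.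
  have h := pinsker_pointwise (f0 x).
  have -> : (w ^+ 2 = (2 * f x + 4) * ent (f x) / 3 + (w - ent (f x) / a) ^+ 2)%R.
    by rewrite /w; field; rewrite gt_eqF.
  by have := sqr_ge0 (w - ent (f x) / a)%R; lra.
have if1 := density_integrable fd.
have ikf := density_integrableM fd (ik nu).
have ic (b : R) : m.-integrable [set: X] (EFin \o (fun=> b)).
  exact: finite_measure_integrable_cst.
have i1 : m.-integrable setT (EFin \o (fun x => k x * f x - k x)%R).
  exact: integrableB_EFin ikf (ik m).
have i2 : m.-integrable setT (EFin \o (fun x => c * (f x - 1))%R).
  exact: integrableZ_EFin (integrableB_EFin if1 (ic 1%R)).
have i3 : m.-integrable setT (EFin \o (fun x => a / 3 * f x)%R).
  exact: integrableZ_EFin.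
have i4 : m.-integrable setT (EFin \o (fun x => (2 * a)^-1 * ent (f x))%R).
  exact: integrableZ_EFin.
have i5 : m.-integrable setT
    (EFin \o (fun x => 2 * a / 3 + (2 * a)^-1 * ent (f x))%R).
  exact: integrableD_EFin (ic _) i4.
have := le_Rintegral measurableT (integrableB_EFin i1 i2)
  (integrableZ_EFin (K / 2) (integrableD_EFin i3 i5)) (fun x _ => pt x).
have intf : (\int[m]_x f x = 1)%R.
  by rewrite /Rintegral (density_integral1 fd).
have i6 := integrableB_EFin if1 (ic 1%R).
rewrite (RintegralB measurableT i1 i2) (RintegralB measurableT ikf (ik m)).
rewrite (RintegralZl c measurableT i6).
rewrite (RintegralB measurableT if1 (ic 1%R)) intf.
rewrite Rintegral_probability_cst subrr mulr0 subr0.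
move=> /le_trans; apply.
rewrite RintegralZl//; last exact: integrableD_EFin.
rewrite RintegralD// RintegralZl// intf RintegralD// RintegralZl//.
rewrite Rintegral_probability_cst RintegralZl//.
have -> : (\int[m]_x ent (f x) = fine (entropy nu m))%R by rewrite (entropyE fd).
by rewrite le_eqVlt; apply/orP; left; apply/eqP; field; rewrite gt_eqF.
Qed.

End relative_entropy.

(** * Dirac masses and measurability of the Euclidean norm *)

Definition dirac_prob d (T : measurableType d) (R : realType) (x : T) :
  probability T R := @dirac _ T x R.
Arguments dirac_prob {d T R} x.

Section square_moment.
Context {R : realType} {d : nat}.

Lemma measurable_euclidean_norm :
  measurable_fun setT (@euclidean_norm R d).
Proof.
apply: (measurableT_comp (continuous_measurable_fun (@sqrt_continuous R))).
apply: measurable_sum => i; apply: measurable_funX.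
exact: measurable_coord.
Qed.

End square_moment.

(** * Integrability, Fubini and bilinearity for pairings; the two-variable test argument *)

Section pairings.
Context {R : realType} {g : geometry} {d : nat}.
Local Notation X := (state_space R g d).
Implicit Types (U : X -> X -> R) (m mu nu : probability X R) (k : X -> R).

Lemma P2_dirac (x : X) : P2 (dirac_prob x : probability X R).
Proof.
rewrite /P2; case: g x => //= x.
rewrite integral_dirac// ?diracT ?mul1e ?ltry//.
apply/measurable_EFinP; apply: measurable_funX.
exact: measurable_euclidean_norm.
Qed.

(** Integrability is required against all of [P2] at once, so that it survives integrating out one
    variable of a kernel and passes to sections. *)
Definition P2_integrable1 k := forall mu, P2 mu ->
  mu.-integrable setT (EFin \o k).

Definition P2_integrable2 U := forall mu nu, P2 mu -> P2 nu ->
  (mu \x nu)%E.-integrable [set: X * X] (EFin \o (fun z => U z.1 z.2)).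

Lemma P2_integrable2D U U' : P2_integrable2 U -> P2_integrable2 U' ->
  P2_integrable2 (fun x y => U x y + U' x y).
Proof.
move=> iU iU' mu nu hmu hnu.
exact: integrableD_EFin (iU _ _ hmu hnu) (iU' _ _ hmu hnu).
Qed.

Lemma P2_integrable2B U U' : P2_integrable2 U -> P2_integrable2 U' ->
  P2_integrable2 (fun x y => U x y - U' x y).
Proof.
move=> iU iU' mu nu hmu hnu.
exact: integrableB_EFin (iU _ _ hmu hnu) (iU' _ _ hmu hnu).
Qed.

Lemma P2_integrable2_swap U : P2_integrable2 U -> P2_integrable2 (fun x y => U y x).
Proof.
move=> iU mu nu hmu hnu; have iUs := iU _ _ hnu hmu.
have mU := measurable_int _ iUs; apply/integrable12ltyP.
  by have := measurableT_comp mU (@measurable_swap _ _ X X).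
exact: (integrable21ltyP _ _ mU).1.
Qed.

Lemma P2_integrable2_fst k : P2_integrable1 k -> P2_integrable2 (fun x _ => k x).
Proof.
move=> ik mu nu hmu hnu; have /integrableP[mk fin] := ik _ hmu.
apply/integrable12ltyP.
  by have := measurableT_comp mk (@measurable_fst _ _ X X).
rewrite (_ : (fun x => _) = (fun x => `|(k x)%:E|%E))//; apply/funext => x /=.
by rewrite integral_cst// [X in (_ * X)%E](@probability_setT _ _ _ nu) mule1.
Qed.

Lemma P2_integrable2_cst (c : R) : P2_integrable2 (fun _ _ => c).
Proof.
apply: (P2_integrable2_fst (k := cst c)) => mu _.
exact: finite_measure_integrable_cst.
Qed.

Lemma P2_integrable2_snd k : P2_integrable1 k -> P2_integrable2 (fun _ y => k y).
Proof.
by move=> ik; exact: (P2_integrable2_swap (P2_integrable2_fst ik)).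
Qed.

Lemma ae_dirac (x : X) (P : X -> Prop) :
  {ae (dirac_prob x : probability X R), forall y, P y} -> P x.
Proof.
move=> [N [mN N0 sN]]; apply: contrapT => Px; have /sN Nx : (~` P) x by [].
by move: N0; rewrite /= diracE mem_set//= => /eqP; rewrite eqe oner_eq0.
Qed.

(* Testing against Dirac masses turns almost every section into every section. *)
Lemma P2_integrable1l U y : P2_integrable2 U -> P2_integrable1 (U^~ y).
Proof.
move=> iU mu hmu; have iy := ae_integrable2 (iU _ _ hmu (P2_dirac y)).
exact: (ae_dirac iy).
Qed.

Lemma P2_integrable1r U x : P2_integrable2 U -> P2_integrable1 (U x).
Proof.
move=> iU mu hmu; have ix := ae_integrable1 (iU _ _ (P2_dirac x) hmu).
exact: (ae_dirac ix).
Qed.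

(** Every section, not just almost every one, is integrable, so the extended-real inner integral is
    finite at every point and [fine] loses nothing. *)
Lemma fubini_F_EFin U mu nu : P2_integrable2 U -> P2 mu -> P2 nu ->
  fubini_F nu (EFin \o (fun z => U z.1 z.2)) = EFin \o (fun x => \int[nu]_y U x y).
Proof.
move=> iU hmu hnu; apply/funext => x; rewrite /fubini_F /Rintegral /= fineK//.
exact/(integrable_fin_num measurableT)/(P2_integrable1r x iU).
Qed.

Lemma fubini_G_EFin U mu nu : P2_integrable2 U -> P2 mu -> P2 nu ->
  fubini_G mu (EFin \o (fun z => U z.1 z.2)) = EFin \o (fun y => \int[mu]_x U x y).
Proof.
move=> iU hmu hnu; apply/funext => x; rewrite /fubini_G /Rintegral /= fineK//.
exact/(integrable_fin_num measurableT)/(P2_integrable1l x iU).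
Qed.

Lemma P2_integrable1_intr U nu : P2_integrable2 U -> P2 nu ->
  P2_integrable1 (fun x => \int[nu]_y U x y).
Proof.
move=> iU hnu mu hmu; rewrite -(fubini_F_EFin iU hmu hnu).
exact: integrable_fubini_F (iU _ _ hmu hnu).
Qed.

Lemma pairing_intr U mu nu : P2_integrable2 U -> P2 mu -> P2 nu ->
  pairing U mu nu = \int[mu]_x \int[nu]_y U x y.
Proof.
move=> iU hmu hnu; rewrite /pairing /Rintegral; congr fine.
rewrite -(integral12_prod_meas1 (iU _ _ hmu hnu)).
by rewrite (fubini_F_EFin iU hmu hnu).
Qed.

Lemma pairing_intl U mu nu : P2_integrable2 U -> P2 mu -> P2 nu ->
  pairing U mu nu = \int[nu]_y \int[mu]_x U x y.
Proof.
move=> iU hmu hnu; rewrite /pairing /Rintegral; congr fine.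
rewrite -(integral21_prod_meas1 (iU _ _ hmu hnu)).
by rewrite (fubini_G_EFin iU hmu hnu).
Qed.

Lemma P2_integrable1_intl U mu : P2_integrable2 U -> P2 mu ->
  P2_integrable1 (fun y => \int[mu]_x U x y).
Proof.
move=> iU hmu nu hnu.
exact: (P2_integrable1_intr (P2_integrable2_swap iU) hmu).
Qed.

Lemma pairingD U U' mu nu : P2_integrable2 U -> P2_integrable2 U' ->
  P2 mu -> P2 nu ->
  pairing (fun x y => U x y + U' x y) mu nu = pairing U mu nu + pairing U' mu nu.
Proof.
by move=> iU iU' hmu hnu; rewrite /pairing RintegralD//; [exact: iU|exact: iU'].
Qed.

Lemma pairingB U U' mu nu : P2_integrable2 U -> P2_integrable2 U' ->
  P2 mu -> P2 nu ->
  pairing (fun x y => U x y - U' x y) mu nu = pairing U mu nu - pairing U' mu nu.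
Proof.
by move=> iU iU' hmu hnu; rewrite /pairing RintegralB//; [exact: iU|exact: iU'].
Qed.

Lemma pairing_fst k mu nu : P2_integrable1 k -> P2 mu -> P2 nu ->
  pairing (fun x _ => k x) mu nu = \int[mu]_x k x.
Proof.
move=> ik hmu hnu; rewrite pairing_intr//; last exact: P2_integrable2_fst.
by apply: eq_Rintegral => x _; rewrite Rintegral_probability_cst.
Qed.

Lemma pairing_snd k mu nu : P2_integrable1 k -> P2 mu -> P2 nu ->
  pairing (fun _ y => k y) mu nu = \int[nu]_y k y.
Proof.
move=> ik hmu hnu; rewrite pairing_intl//; last exact: P2_integrable2_snd.
by apply: eq_Rintegral => x _; rewrite Rintegral_probability_cst.
Qed.

Lemma pairing_cst (c : R) mu nu : pairing (fun _ _ => c) mu nu = c.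
Proof. exact: Rintegral_probability_cst. Qed.

Lemma pairing_diffD U U' nu m : P2_integrable2 U -> P2_integrable2 U' ->
  P2 nu -> P2 m -> pairing_diff (fun x y => U x y + U' x y) nu m =
  pairing_diff U nu m + pairing_diff U' nu m.
Proof.
by move=> iU iU' hnu hm; rewrite /pairing_diff !pairingD//; ring.
Qed.

Lemma pairing_diffB U U' nu m : P2_integrable2 U -> P2_integrable2 U' ->
  P2 nu -> P2 m -> pairing_diff (fun x y => U x y - U' x y) nu m =
  pairing_diff U nu m - pairing_diff U' nu m.
Proof.
by move=> iU iU' hnu hm; rewrite /pairing_diff !pairingB//; ring.
Qed.

Lemma pairing_diff_fst k nu m : P2_integrable1 k -> P2 nu -> P2 m ->
  pairing_diff (fun x _ => k x) nu m = 0.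
Proof. by move=> ik hnu hm; rewrite /pairing_diff !pairing_fst//; ring. Qed.

Lemma pairing_diff_snd k nu m : P2_integrable1 k -> P2 nu -> P2 m ->
  pairing_diff (fun _ y => k y) nu m = 0.
Proof. by move=> ik hnu hm; rewrite /pairing_diff !pairing_snd//; ring. Qed.

(** For probability measures, centring the kernel at [m] amounts to centring the measures: the
    right-hand side is [U] integrated against the product of [mu - m] and [nu - m]. *)
Lemma pairing_reduced U m mu nu : P2_integrable2 U -> P2 m -> P2 mu -> P2 nu ->
  pairing (reduced U m) mu nu =
  pairing U mu nu - pairing U mu m - pairing U m nu + pairing U m m.
Proof.
move=> iU hm hmu hnu; have ir := P2_integrable1_intr iU hm.
have il := P2_integrable1_intl iU hm.
have i1 := P2_integrable2B iU (P2_integrable2_fst ir).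
have i2 := P2_integrable2B i1 (P2_integrable2_snd il).
rewrite pairingD//; last exact: P2_integrable2_cst.
rewrite pairingB//; last exact: P2_integrable2_snd.
rewrite pairingB//; last exact: P2_integrable2_fst.
rewrite pairing_fst// pairing_snd// pairing_cst.
by rewrite (pairing_intr iU hmu hm) (pairing_intl iU hm hnu).
Qed.

Lemma pairing_reduced_diag U m nu : P2_integrable2 U -> P2 m -> P2 nu ->
  pairing (reduced U m) nu nu = pairing_diff U nu m.
Proof. by move=> iU hm hnu; rewrite pairing_reduced. Qed.

(** The pairing of [U] with the product of [delta_x - delta_y] and [delta_z - delta_w], whose
    supremum is [Osc2 U]. *)
Definition second_difference U (x y z w : X) := U x z - U x w - U y z + U y w.

(* The bound on [nu - m] is used once in each variable of [U]. *)
Lemma pairing_diff_le U (p : X -> X -> R) (L S : R) nu m :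
  P2_integrable2 U -> P2 nu -> P2 m -> (forall x y, 0 <= p x y) ->
  0 <= L -> 0 <= S ->
  (forall k (K : R), P2_integrable1 k -> 0 <= K ->
     (forall x y, k x - k y <= K * p x y) ->
     \int[nu]_x k x - \int[m]_x k x <= K * S) ->
  (forall x y z w, second_difference U x y z w <= L * p x y * p z w) ->
  pairing_diff U nu m <= L * S ^+ 2.
Proof.
move=> iU hnu hm p0 L0 S0 test UL.
pose k z := \int[nu]_x U x z - \int[m]_x U x z.
have ik : P2_integrable1 k.
  move=> mu hmu; exact: integrableB_EFin (P2_integrable1_intl iU hnu hmu)
    (P2_integrable1_intl iU hm hmu).
have i1 z := P2_integrable1l z iU.
(* First use of [test], on the function of [x] given by [U x z - U x w], with constant [L * p z w].
   It makes [k] admissible with constant [L * S] for the second use. *)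
have kp z w : k z - k w <= (L * S) * p z w.
  have -> : k z - k w =
      \int[nu]_x (U x z - U x w) - \int[m]_x (U x z - U x w).
    by rewrite !RintegralB//; [rewrite /k; ring|exact: i1..].
  have -> : L * S * p z w = L * p z w * S by ring.
  apply: test; first by move=> mu hmu; apply: integrableB_EFin; exact: i1.
    exact: mulr_ge0.
  by move=> x y; have := UL x y z w; rewrite /second_difference; lra.
have := test k (L * S) ik (mulr_ge0 L0 S0) kp.
rewrite -mulrA -expr2; congr (_ <= _); rewrite /k.
have il := P2_integrable1_intl iU.
rewrite !RintegralB//; [|exact: il..].
rewrite -!pairing_intl// /pairing_diff; ring.
Qed.

End pairings.

(** * The mean of finitely many probability measures *)

Section mixture.
Context d (T : measurableType d) (R : realType).
Context (n : nat) (xi : nat -> probability T R).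

(** The family is indexed by [nat] because [msum] adds the first terms of a sequence; taking [n.+1]
    terms keeps the weight invertible. *)
Definition mixture : set T -> \bar R :=
  mscale (n.+1%:R^-1)%:nng (msum (fun i => xi i : {measure set T -> \bar R}) n.+1).

HB.instance Definition _ := Measure.on mixture.

Lemma mixtureE A : mixture A = (n.+1%:R^-1%:E * \sum_(i < n.+1) xi i A)%E.
Proof. by []. Qed.

Lemma mixture_setT : mixture setT = 1%E.
Proof.
rewrite mixtureE (eq_bigr (fun=> 1%E)) => [|i _]; last exact: probability_setT.
by rewrite sumEFin sumr_const card_ord -EFinM mulVf.
Qed.

HB.instance Definition _ :=
  Measure_isProbability.Build _ _ _ mixture mixture_setT.

Lemma ge0_integral_mixture (f : T -> \bar R) : measurable_fun setT f ->
  (forall x, 0 <= f x)%E ->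
  (\int[mixture]_x f x = n.+1%:R^-1%:E * \sum_(i < n.+1) \int[xi i]_x f x)%E.
Proof.
by move=> mf f0; rewrite ge0_integral_mscale// ge0_integral_measure_sum.
Qed.

Lemma integrable_mixture (f : T -> R) :
  (forall i, (xi i).-integrable setT (EFin \o f)) ->
  mixture.-integrable setT (EFin \o f).
Proof.
move=> fi; have mf := measurable_int _ (fi 0%N); apply/integrableP; split => //.
rewrite ge0_integral_mixture//; last exact: measurableT_comp.
rewrite lte_mul_pinfty ?lee_fin//; apply/lte_sum_pinfty => i _.
by have /integrableP[] := fi i.
Qed.

Lemma Rintegral_mixture (f : T -> R) :
  (forall i, (xi i).-integrable setT (EFin \o f)) ->
  \int[mixture]_x f x = n.+1%:R^-1 * \sum_(i < n.+1) \int[xi i]_x f x.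
Proof.
have ge0 (h : T -> R) : (forall x, 0 <= h x) ->
    (forall i, (xi i).-integrable setT (EFin \o h)) ->
    \int[mixture]_x h x = n.+1%:R^-1 * \sum_(i < n.+1) \int[xi i]_x h x.
  move=> h0 hi; have mh := measurable_int _ (hi 0%N).
  rewrite /Rintegral ge0_integral_mixture// fineM//=; last first.
    by apply/sum_fin_numP => i _ _; exact: (integrable_fin_num measurableT (hi i)).
  by rewrite sum_fine// => i _; exact: (integrable_fin_num measurableT (hi i)).
move=> fi; have ni i := integrable_norm (fi i).
have nfi i := integrableD_EFin (ni i) (fi i).
(* A difference of two nonnegative integrable functions, to which the case [ge0] applies. *)
have -> : f = (fun x => (`|f x| + f x) - `|f x|).
  by apply/funext => x; rewrite addrAC subrr add0r.
rewrite RintegralB//; [|exact: integrable_mixture nfi|exact: integrable_mixture ni].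
rewrite ge0//; last by move=> x; have := ler_norm (- f x); rewrite normrN; lra.
rewrite ge0// -mulrBr -sumrB; congr (_ * _); apply: eq_bigr => i _.
by rewrite RintegralB.
Qed.

End mixture.

(** * Second moment, pairing and entropy of the mean measure *)

Section mixture_functionals.
Context {R : realType} {g : geometry} {d : nat}.
Local Notation X := (state_space R g d).
Implicit Types (U : X -> X -> R) (m : probability X R).
Context (n : nat) (xi : nat -> probability X R).
Local Notation xibar := (mixture n xi : probability X R).

Lemma P2_mixture : (forall i, P2 (xi i)) -> P2 xibar.
Proof.
move: xi; rewrite /P2; case: g => //= xi' hxi.
rewrite ge0_integral_mixture//.
- by rewrite lte_mul_pinfty ?lee_fin//; apply/lte_sum_pinfty => i _; exact: hxi.
- apply/measurable_EFinP; apply: measurable_funX.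
  exact: measurable_euclidean_norm.
- by move=> x; rewrite lee_fin sqr_ge0.
Qed.

Lemma pairing_mixture U : P2_integrable2 U -> (forall i, P2 (xi i)) ->
  pairing U xibar xibar =
  n.+1%:R^-1 ^+ 2 * \sum_(i < n.+1) \sum_(j < n.+1) pairing U (xi i) (xi j).
Proof.
move=> iU hxi; have hbar := P2_mixture hxi.
rewrite pairing_intr//.
have ir := P2_integrable1_intr iU hbar.
rewrite Rintegral_mixture; last by move=> i; exact: ir.
rewrite expr2 -mulrA; congr (_ * _); rewrite mulr_sumr.
apply: eq_bigr => i _; rewrite -pairing_intr// pairing_intl//.
have il := P2_integrable1_intl iU (hxi i).
rewrite Rintegral_mixture; last by move=> j; exact: il.
by congr (_ * _); apply: eq_bigr => j _; rewrite -pairing_intl.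
Qed.

(** Convexity of the entropy: the mean of the densities is a density of the mixture, and
    [ent_jensen] holds under the integral. *)
Lemma entropy_mixture m : (forall i, (entropy (xi i) m < +oo)%E) ->
  (entropy xibar m <=
   (n.+1%:R^-1 * \sum_(i < n.+1) fine (entropy (xi i) m))%:E)%E.
Proof.
move=> fin.
have /choice[f fd] : forall i, exists f, is_density (xi i) m f.
  by move=> i; exact: finite_entropy_density.
have mf i : measurable_fun setT (f i) by have [] := fd i.
have f0 i x : 0 <= f i x by have [] := fd i.
pose fbar x := n.+1%:R^-1 * \sum_(i < n.+1) f i x.
have fbard : is_density xibar m fbar.
  split.
  - by apply: measurable_funM => //; apply: measurable_sum.
  - by move=> x; rewrite mulr_ge0// sumr_ge0.
  - move=> A mA; rewrite /= mixtureE.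
    under [RHS]eq_integral do rewrite EFinM -sumEFin.
    rewrite ge0_integralZl//; last 2 first.
    + apply: emeasurable_sum => i; apply/measurable_EFinP.
      exact: measurable_funTS.
    + by move=> x _; apply: sume_ge0 => i _; rewrite lee_fin.
    rewrite ge0_integral_sum//; last 2 first.
    + by move=> i; apply/measurable_EFinP; exact: measurable_funTS.
    + by move=> i x _; rewrite lee_fin.
    by congr (_ * _)%E; apply: eq_bigr => i _; have [_ _ ->] := fd i.
have ment i : measurable_fun setT (fun x => (ent (f i x))%:E).
  by apply/measurable_EFinP; exact: (measurableT_comp measurable_ent (mf i)).
have ent0 i x : (0 <= (ent (f i x))%:E)%E by rewrite lee_fin ent_ge0.
rewrite (entropyE fbard).
apply: (@le_trans _ _ (\int[m]_x
  (n.+1%:R^-1%:E * \sum_(i < n.+1) (ent (f i x))%:E)%E)%E).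
  apply: ge0_le_integral => //.
  - by move=> x _; rewrite lee_fin ent_ge0//; case: fbard.
  - apply/measurable_EFinP; have [mfb _ _] := fbard.
    exact: (measurableT_comp measurable_ent mfb).
  - by apply: measurable_funeM; exact: emeasurable_sum.
  - move=> x _; rewrite sumEFin -EFinM lee_fin.
    exact: (@ent_jensen R n (fun i => f i x)).
rewrite ge0_integralZl//; last 2 first.
- exact: emeasurable_sum.
- by move=> x _; exact: sume_ge0.
rewrite ge0_integral_sum//.
rewrite EFinM lee_pmul2l// -sumEFin lee_sum// => i _.
rewrite fineK; first by rewrite (entropyE (fd i)).
by rewrite ge0_fin_numE// entropy_ge0.
Qed.

End mixture_functionals.

(** * Couplings and the consequence of Talagrand's inequality for Lipschitz functions *)

Section transport.
Context {R : realType} {d : nat}.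
Local Notation X := (state_space R Euclidean d).
Implicit Types (m nu : probability X R) (k : X -> R).

Lemma coupling_integrals nu m (pi : probability (X * X)%type R) k :
  coupling nu m pi -> nu.-integrable setT (EFin \o k) ->
  m.-integrable setT (EFin \o k) ->
  [/\ pi.-integrable setT (EFin \o (fun z => k z.1)),
      pi.-integrable setT (EFin \o (fun z => k z.2)),
      \int[nu]_x k x = \int[pi]_z k z.1 &
      \int[m]_x k x = \int[pi]_z k z.2].
Proof.
move=> cpi inu im.
have mk : measurable_fun setT (EFin \o k) := measurable_int _ inu.
have marginal (mu : probability X R) (h : X * X -> X) : measurable_fun setT h ->
    (forall A, measurable A -> pi (h @^-1` A) = mu A) ->
    mu.-integrable setT (EFin \o k) ->
    pi.-integrable setT (EFin \o (k \o h)) /\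
    \int[mu]_x k x = \int[pi]_z k (h z).
  move=> mh piE ik.
  have ih : pi.-integrable setT (EFin \o (k \o h)).
    apply/integrableP; split; first exact: (measurableT_comp mk mh).
    have /integrableP[_] := ik; congr (_ < _)%E.
    rewrite (eq_measure_integral (pushforward pi h)); last first.
      by move=> A mA _; rewrite /pushforward; exact/esym/piE.
    rewrite ge0_integral_pushforward ?preimage_setT//.
    exact: measurableT_comp.
  split=> //; rewrite /Rintegral; congr fine.
  rewrite (eq_measure_integral (pushforward pi h)); last first.
    by move=> A mA _; rewrite /pushforward; exact/esym/piE.
  by rewrite integral_pushforward ?preimage_setT.
have [i1 e1] := marginal nu fst measurable_fst (fun A mA => (cpi A mA).1) inu.
have [i2 e2] := marginal m snd measurable_snd (fun A mA => (cpi A mA).2) im.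
by [].
Qed.

(** Squaring undoes the power [2^-1] because the infimum is nonnegative, and a strict upper bound on
    an infimum exceeds the cost of some coupling. *)
Lemma W2_sq_coupling nu m (c : R) : (W2 nu m ^+ 2 < c%:E)%E ->
  exists2 pi : probability (X * X)%type R, coupling nu m pi &
    (\int[pi]_z (euclidean_norm (z.1 - z.2) ^+ 2)%:E < c%:E)%E.
Proof.
rewrite /W2; set S := [set _ | _ in _]; move=> h.
have S0 s : S s -> (0 <= s)%E.
  by move=> [pi _ <-]; apply: integral_ge0 => z _; rewrite lee_fin sqr_ge0.
have : (ereal_inf S < c%:E)%E.
  have : (0 <= ereal_inf S)%E by apply: le_ereal_inf_tmp.
  move: h; case: (ereal_inf S) => [r||]//.
    rewrite poweR_EFin -EFin_expe !lte_fin lee_fin => h r0.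
    by move: h; rewrite -powR_mulrn ?powR_ge0// -powRrM mulVf// powRr1.
  by rewrite poweRyr// expe2 mulyy.
move=> /ereal_inf_lt[_ [pi cpi <-] lt].
by exists pi.
Qed.

Lemma measurable_euclidean_dist :
  measurable_fun setT (fun z : X * X => euclidean_norm (z.1 - z.2)).
Proof.
apply: (measurableT_comp (@measurable_euclidean_norm R d)).
apply: measurable_fun_coordP => i.
rewrite (_ : (fun _ => _) = fun z : X * X => z.1 ord0 i - z.2 ord0 i).
  apply: measurable_funB.
    exact: (measurableT_comp (measurable_coord i) measurable_fst).
  exact: (measurableT_comp (measurable_coord i) measurable_snd).
by apply/funext => z; rewrite !mxE.
Qed.

(** The left-hand side is the integral of [k z.1 - k z.2] against any coupling. For a nearly optimal
    one, Young's inequality with parameter [a] bounds it through the squared transport cost, and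
    [am_gm_sqrt] optimises [a]. *)
Lemma talagrand_test (rho K : R) nu m k : 0 < rho -> talagrand rho m ->
  P2 nu -> (entropy nu m < +oo)%E ->
  nu.-integrable setT (EFin \o k) -> m.-integrable setT (EFin \o k) ->
  0 <= K -> (forall x y, k x - k y <= K * euclidean_norm (x - y)) ->
  \int[nu]_x k x - \int[m]_x k x
    <= K * Num.sqrt (2 * fine (entropy nu m) / rho).
Proof.
move=> rho0 tal hnu fin inu im K0 kK.
set H := fine (entropy nu m).
have H0 : 0 <= H by rewrite fine_ge0// entropy_ge0.
have HE : entropy nu m = H%:E by rewrite fineK// ge0_fin_numE// entropy_ge0.
apply: am_gm_sqrt => //; first by rewrite divr_ge0 ?mulr_ge0// ltW.
move=> a a0; apply/ler_addgt0Pr => e e0.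
(* [b] bounds the squared distance by Talagrand's inequality. The slack [c - b] is chosen so that,
   multiplied by [K / (2 * a)], it contributes [e * (K / (K + 1))], at most [e]. *)
set b := 2 * H / rho; pose c := b + e * (2 * a) / (K + 1).
have c1 : b < c by rewrite ltrDl divr_gt0 ?mulr_gt0//; lra.
have [pi cpi ltc] : exists2 pi : probability (X * X)%type R, coupling nu m pi &
    (\int[pi]_z (euclidean_norm (z.1 - z.2) ^+ 2)%:E < c%:E)%E.
  apply: W2_sq_coupling; apply: le_lt_trans (_ : b%:E < _)%E => //.
  have := tal nu hnu; rewrite HE.
  have W0 : (0 <= W2 nu m ^+ 2)%E by apply: sqre_ge0.
  rewrite -lee_pdivlMl; last by rewrite divr_gt0.
  by rewrite -EFinM (_ : (rho / 2)^-1 * H = b)// /b; field; rewrite gt_eqF.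
pose D z : R := euclidean_norm (z.1 - z.2 : 'rV[R]_d) ^+ 2.
have iD : pi.-integrable setT (EFin \o D).
  apply/integrableP; split.
    apply/measurable_EFinP/measurable_funX; exact: measurable_euclidean_dist.
  under eq_integral do rewrite gee0_abs ?lee_fin ?sqr_ge0//.
  exact: lt_trans ltc (ltry _).
have Dc : \int[pi]_z D z <= c.
  rewrite -lee_fin /Rintegral fineK; first exact: ltW.
  exact: (integrable_fin_num measurableT iD).
have [i1 i2 -> ->] := coupling_integrals cpi inu im.
have i3 : pi.-integrable setT (EFin \o (fun=> K / 2 * a)).
  exact: finite_measure_integrable_cst.
have i4 := integrableZ_EFin (K / (2 * a)) iD.
rewrite -RintegralB//.
have pt z : k z.1 - k z.2 <= K / 2 * a + K / (2 * a) * D z.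
  apply: (le_trans (kK _ _)); rewrite /D.
  move: (euclidean_norm _) => t.
  rewrite -subr_ge0 (_ : _ - _ = K / (2 * a) * (t - a) ^+ 2); last first.
    by field; rewrite gt_eqF.
  by rewrite mulr_ge0 ?sqr_ge0// divr_ge0//; lra.
have := le_Rintegral measurableT (integrableB_EFin i1 i2)
  (integrableD_EFin i3 i4) (fun z _ => pt z).
move=> /le_trans; apply; rewrite (RintegralD measurableT i3 i4).
rewrite Rintegral_probability_cst RintegralZl//.
have : K / (2 * a) * \int[pi]_z D z <= K / (2 * a) * c.
  by apply: ler_wpM2l => //; rewrite divr_ge0//; lra.
move=> /(lerD (lexx (K / 2 * a))) /le_trans; apply.
have -> : K / 2 * a + K / (2 * a) * c =
    K / 2 * (a + b / a) + e * (K / (K + 1)).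
  by rewrite /c; field; apply/andP; split; lra.
rewrite lerD2l; apply: ler_piMr; first exact: ltW.
by rewrite ler_pdivrMr; lra.
Qed.

End transport.

(** * Second differences bounded by the mixed Hessian *)

Section mixed_second_difference.
Context {R : realType} {d : nat}.
Implicit Types (u v x y z w : 'rV[R]_d).

Lemma euclidean_norm_ge0 u : 0 <= euclidean_norm u.
Proof. exact: sqrtr_ge0. Qed.

Lemma euclidean_norm_sqr u : euclidean_norm u ^+ 2 = \sum_i u ord0 i ^+ 2.
Proof. by rewrite sqr_sqrtr// sumr_ge0// => i _; exact: sqr_ge0. Qed.

Lemma euclidean_normZ (a : R) u : 0 <= a ->
  euclidean_norm (a *: u) = a * euclidean_norm u.
Proof.
move=> a0; rewrite /euclidean_norm.
under eq_bigr do rewrite mxE exprMn.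
by rewrite -mulr_sumr sqrtrM ?sqr_ge0// sqrtr_sqr ger0_norm.
Qed.

Lemma euclidean_norm_eq0 u : euclidean_norm u = 0 -> u = 0.
Proof.
move=> u0; have := euclidean_norm_sqr u; rewrite u0 expr0n/= => /esym/eqP.
rewrite psumr_eq0 => [/allP h|i _]; last exact: sqr_ge0.
apply/rowP => i; rewrite mxE; apply/eqP; rewrite -sqrf_eq0.
by apply: h; rewrite mem_index_enum.
Qed.

(** With [a] and [b] the norms of [u] and [v], expand the squared norm of [b *: u - a *: v] and
    divide by [2 * (a * b)]; the cases of a zero vector are separate. *)
Lemma euclidean_cauchy_schwarz u v :
  \sum_i u ord0 i * v ord0 i <= euclidean_norm u * euclidean_norm v.
Proof.
set a := euclidean_norm u; set b := euclidean_norm v.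
have a0 : 0 <= a := euclidean_norm_ge0 u.
have b0 : 0 <= b := euclidean_norm_ge0 v.
have [/eqP a00|an0] := boolP (a == 0).
  rewrite (euclidean_norm_eq0 a00) a00 mul0r big1// => i _.
  by rewrite mxE mul0r.
have [/eqP b00|bn0] := boolP (b == 0).
  rewrite (euclidean_norm_eq0 b00) b00 mulr0 big1// => i _.
  by rewrite mxE mulr0.
have ab : 0 < 2 * (a * b) by rewrite !mulr_gt0// lt_neqAle eq_sym ?an0 ?bn0.
rewrite -(ler_pM2l ab) -subr_ge0.
have -> : 2 * (a * b) * (a * b) - 2 * (a * b) * \sum_i u ord0 i * v ord0 i =
    \sum_i (b * u ord0 i - a * v ord0 i) ^+ 2.
  under [RHS]eq_bigr do rewrite sqrrB !exprMn.
  rewrite big_split/= sumrB -!mulr_sumr -!euclidean_norm_sqr.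
  rewrite -/a -/b.
  have -> : \sum_i b * u ord0 i * (a * v ord0 i) *+ 2 =
      \sum_i (2 * (a * b)) * (u ord0 i * v ord0 i).
    by apply: eq_bigr => i _; rewrite -mulr_natl; ring.
  by rewrite -mulr_sumr; ring.
by apply: sumr_ge0 => i _; exact: sqr_ge0.
Qed.

(** The double sum is the inner product of [u *m A] with [v]. Normalising [u] brings it into the
    unit ball over which [operator_norm] is a supremum. *)
Lemma operator_norm_bilinear (A : 'M[R]_d) (L : R) u v :
  (operator_norm A <= L%:E)%E ->
  \sum_i \sum_j u ord0 i * v ord0 j * A i j
    <= L * euclidean_norm u * euclidean_norm v.
Proof.
move=> AL.
have uAL : euclidean_norm (u *m A) <= L * euclidean_norm u.
  have [/eqP u0|un0] := boolP (euclidean_norm u == 0).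
    rewrite u0 (euclidean_norm_eq0 u0) mul0mx mulr0.
    by rewrite /euclidean_norm big1 ?sqrtr0// => i _; rewrite mxE expr0n.
  have nu : 0 < euclidean_norm u by rewrite lt_neqAle eq_sym un0 euclidean_norm_ge0.
  have iu : 0 <= (euclidean_norm u)^-1 by rewrite invr_ge0 ltW.
  rewrite -ler_pdivrMr// mulrC -euclidean_normZ// scalemxAl.
  rewrite -lee_fin; apply: le_trans AL.
  apply: ereal_sup_ubound; exists ((euclidean_norm u)^-1 *: u) => //=.
  by rewrite euclidean_normZ// mulVf.
apply: le_trans (ler_wpM2r (euclidean_norm_ge0 v) uAL).
apply: le_trans (euclidean_cauchy_schwarz _ _).
rewrite exchange_big/= le_eqVlt; apply/orP; left; apply/eqP.
apply: eq_bigr => j _; rewrite mxE mulr_suml; apply: eq_bigr => i _; ring.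
Qed.

Lemma derive_basis (f : 'rV[R]_d -> R) x v : differentiable f x ->
  'D_v f x = \sum_i v ord0 i * 'D_(delta_mx ord0 i) f x.
Proof.
move=> df; rewrite deriveE// {1}(row_sum_delta v) linear_sum.
by apply: eq_bigr => i _; rewrite linearZ/= deriveE.
Qed.

(** The mean value theorem along a segment. The position of [c] is not recorded, since the bound on
    the Hessian is global. *)
Lemma mean_value_line (f : 'rV[R]_d -> R) x v :
  (forall y, differentiable f y) ->
  exists c, f (x + v) - f x = 'D_v f (x + c *: v).
Proof.
move=> df; pose h (t : R) := f (x + t *: v).
have dh (t : R) : is_derive t (1 : R) h ('D_v f (x + t *: v)).
  have quotE : (fun s : R => s^-1 *: ((h \o shift t) (s *: (1 : R)) - h t)) =
      (fun s : R => s^-1 *: ((f \o shift (x + t *: v)) (s *: v) - f (x + t *: v))).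
    apply/funext => s; rewrite /h /=; congr (_ *: (f _ - _)).
    by rewrite [s *: (1 : R)]mulr1 scalerDl addrCA.
  have dfv : derivable f (x + t *: v) v by exact: diff_derivable.
  apply: DeriveDef; first by rewrite /derivable quotE.
  by rewrite /derive quotE.
have ch : {within `[0, 1], continuous h}.
  apply: derivable_within_continuous => t _; by have [] := dh t.
have [c _] := MVT ltr01 (fun t _ => dh t) ch.
rewrite /h scale1r scale0r addr0 subr0 mulr1 => ->.
by exists c.
Qed.

(** Two mean value steps: in the second variable for [U x - U y], then in the first for the
    resulting directional derivative. They turn the second difference into the bilinear form of the
    mixed Hessian at one point [(p, q)]. *)
Lemma second_difference_le (U : 'rV[R]_d -> 'rV[R]_d -> R) (L : R) x y z w :
  mixed_differentiable U -> (mixed_hessian_norm U <= L%:E)%E ->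
  U x z - U x w - U y z + U y w
    <= L * euclidean_norm (x - y) * euclidean_norm (z - w).
Proof.
move=> [dU ddU] UL.
pose f := fun t => U x t - U y t.
have df t : differentiable f t by exact: differentiableB.
have [c] := mean_value_line w (z - w) df.
rewrite subrKC; set q := w + _ => e1.
have [c'] := mean_value_line y (x - y) (ddU q (z - w)).
rewrite subrKC; set p := y + _ => e2.
have -> : U x z - U x w - U y z + U y w =
    \sum_i \sum_j (x - y) ord0 i * (z - w) ord0 j * mixed_hessian U p q i j.
  transitivity (f z - f w); first by rewrite /f; ring.
  rewrite e1 deriveB ?e2; try exact: diff_derivable.
  rewrite derive_basis//; apply: eq_bigr => i _.
  under [RHS]eq_bigr do rewrite -mulrA.
  rewrite -mulr_sumr; congr (_ * _).
  pose D j x' : R := 'D_(delta_mx ord0 j) (U x') q.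
  have dD j t : derivable (D j) t (delta_mx ord0 i).
    by apply: diff_derivable; exact: ddU.
  rewrite (_ : (fun x' => _) = \sum_j (z - w) ord0 j *: D j); last first.
    by apply/funext => x'; rewrite fct_sumE; exact: derive_basis.
  rewrite derive_sum; last by move=> j; exact: derivableZ.
  by apply: eq_bigr => j _; rewrite deriveZ ?mxE.
apply: operator_norm_bilinear; apply: le_trans UL.
by apply: ereal_sup_ubound; exists (p, q).
Qed.

End mixed_second_difference.

(** * Kernels modulo functions of one variable, and the bounded case *)

Section recentering.
Context {R : realType} {g : geometry} {d : nat}.
Local Notation X := (state_space R g d).
Implicit Types (U : X -> X -> R) (m nu : probability X R).

(** Bounded second differences bound a kernel only up to functions of one variable, so the two parts
    of a decomposition need not be integrable separately. This normalisation removes such functions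
    and keeps all second differences. *)
Definition recenter U (x z : X) := second_difference U x point z point.

Lemma second_difference_recenter U x y z w :
  second_difference (recenter U) x y z w = second_difference U x y z w.
Proof. by rewrite /second_difference /recenter /second_difference; ring. Qed.

Lemma P2_integrable2_recenter U : P2_integrable2 U -> P2_integrable2 (recenter U).
Proof.
move=> iU; apply: P2_integrable2D; last exact: P2_integrable2_cst.
apply: P2_integrable2B; last first.
  exact: P2_integrable2_snd (P2_integrable1r point iU).
apply: P2_integrable2B => //.
exact: P2_integrable2_fst (P2_integrable1l point iU).
Qed.

(** The terms removed depend on at most one variable, and [nu - m] has mass zero. *)
Lemma pairing_diff_recenter U nu m : P2_integrable2 U -> P2 nu -> P2 m ->
  pairing_diff (recenter U) nu m = pairing_diff U nu m.
Proof.
move=> iU hnu hm.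
have ik := P2_integrable1l point iU; have ik' := P2_integrable1r point iU.
have i1 := P2_integrable2B iU (P2_integrable2_fst ik).
have i2 := P2_integrable2B i1 (P2_integrable2_snd ik').
rewrite pairing_diffD//; last exact: P2_integrable2_cst.
rewrite pairing_diffB//; last exact: P2_integrable2_snd.
rewrite pairing_diffB//; last exact: P2_integrable2_fst.
rewrite pairing_diff_fst// pairing_diff_snd//.
by rewrite {2}/pairing_diff !pairing_cst; ring.
Qed.

Lemma borel_recenter U : borel_kernel U -> borel_kernel (recenter U).
Proof.
move=> mU.
have comp (h : X * X -> X * X) : measurable_fun setT h ->
    measurable_fun setT (fun z => U (h z).1 (h z).2).
  exact: measurableT_comp mU.
apply: measurable_funD => //; apply: measurable_funB.
  apply: measurable_funB => //.
  by apply: (comp (fun z => (z.1, point))); exact: measurable_fun_pair.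
by apply: (comp (fun z => (point, z.2))); exact: measurable_fun_pair.
Qed.

Lemma bounded_recenter_integrable U (C : R) : borel_kernel U ->
  (forall x y z w, second_difference U x y z w <= C) ->
  P2_integrable2 (recenter U).
Proof.
move=> mU UC mu nu hmu hnu.
apply: le_integrable (P2_integrable2_cst C hmu hnu) => //.
  by apply/measurable_EFinP; have := borel_recenter mU.
move=> z _ /=; rewrite lee_fin; apply: le_trans (ler_norm _).
(* Exchanging the first two arguments reverses the sign of a second difference, so the upper bound
   is two-sided. *)
have := UC z.1 point z.2 point; have := UC point z.1 z.2 point.
by rewrite /recenter /second_difference ler_norml; lra.
Qed.

Lemma Osc2_ge0 U : (0 <= Osc2 U)%E.
Proof.
apply: ereal_sup_ubound; exists point, point, point, point.
by congr EFin; ring.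
Qed.

Lemma Osc2_sum_bound U U' (C : R) : (Osc2 U + Osc2 U' <= C%:E)%E ->
  forall x y z w, second_difference U x y z w <= C.
Proof.
move=> UC x y z w; rewrite -lee_fin; apply: le_trans UC.
apply: (@le_trans _ _ (Osc2 U)); last by rewrite leeDl ?Osc2_ge0.
by apply: ereal_sup_ubound; exists x, y, z, w.
Qed.

(** [pairing_diff_le] with the constant 1 as pseudo-distance: the test functions are those of
    bounded oscillation, and Pinsker gives [S ^+ 2] equal to half the entropy. *)
Lemma pairing_diff_bounded U (C : R) nu m : P2_integrable2 U ->
  (forall x y z w, second_difference U x y z w <= C) ->
  P2 nu -> P2 m -> (entropy nu m < +oo)%E ->
  pairing_diff U nu m <= C * (fine (entropy nu m) / 2).
Proof.
move=> iU UC hnu hm fin.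
have H0 : 0 <= fine (entropy nu m) by rewrite fine_ge0// entropy_ge0.
have H20 : 0 <= fine (entropy nu m) / 2 by rewrite divr_ge0.
rewrite -(sqr_sqrtr H20).
apply: (@pairing_diff_le _ _ _ U (fun _ _ => 1)) => //.
- have := UC point point point point; rewrite /second_difference; lra.
- move=> k K ik _ kK; apply: pinsker => //.
    exact/measurable_EFinP/(measurable_int _ (ik _ hm)).
  by move=> x y; rewrite -(mulr1 K).
- by move=> x y z w; rewrite !mulr1.
Qed.

Lemma P2_integrable2_reduced U m : P2_integrable2 U -> P2 m ->
  P2_integrable2 (reduced U m).
Proof.
move=> iU hm; apply: P2_integrable2D; last exact: P2_integrable2_cst.
apply: P2_integrable2B; last exact: P2_integrable2_snd (P2_integrable1_intl iU hm).
by apply: P2_integrable2B => //; exact: P2_integrable2_fst (P2_integrable1_intr iU hm).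
Qed.

End recentering.

(** * The diagonal bound for decomposable kernels *)

Section decomposable_kernels.
Context {R : realType} {d : nat}.

Lemma mixed_hessian_norm_ge0 (U : 'rV[R]_d -> 'rV[R]_d -> R) :
  (0 <= mixed_hessian_norm U)%E.
Proof.
apply: (@le_trans _ _ (operator_norm (mixed_hessian U 0 0))).
  have norm0 : euclidean_norm (0 : 'rV[R]_d) = 0.
    by rewrite /euclidean_norm big1 ?sqrtr0// => i _; rewrite mxE expr0n.
  by apply: ereal_sup_ubound; exists 0 => /=; rewrite ?mul0mx norm0.
by apply: ereal_sup_ubound; exists (0, 0).
Qed.

(** [pairing_diff_le] for the Euclidean distance, with [S] supplied by [talagrand_test]. *)
Lemma pairing_diff_quadratic (U : state_space R Euclidean d ->
    state_space R Euclidean d -> R) (L rho : R)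
    (nu m : probability (state_space R Euclidean d) R) :
  P2_integrable2 U -> 0 <= L -> 0 < rho -> talagrand rho m ->
  (forall x y z w, second_difference U x y z w <=
     L * euclidean_norm (x - y) * euclidean_norm (z - w)) ->
  P2 nu -> P2 m -> (entropy nu m < +oo)%E ->
  pairing_diff U nu m <= L * (2 * fine (entropy nu m) / rho).
Proof.
move=> iU L0 rho0 tal UL hnu hm fin.
have H0 : 0 <= fine (entropy nu m) by rewrite fine_ge0// entropy_ge0.
have H20 : 0 <= 2 * fine (entropy nu m) / rho.
  by rewrite divr_ge0 ?mulr_ge0// ltW.
rewrite -(sqr_sqrtr H20).
apply: (@pairing_diff_le _ _ _ U (fun x y => euclidean_norm (x - y))) => //.
- by move=> x y; exact: euclidean_norm_ge0.
- by move=> k K ik K0 kK; apply: talagrand_test => //; exact: ik.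
Qed.

Lemma decomposable_integrable (g : geometry)
    (W : state_space R g d -> state_space R g d -> R) (M L : R) :
  decomposable W M L -> P2_integrable2 W.
Proof.
move=> [Wp [Wm [WE [_ _ _ [iWp _]] [_ _ _ [iWm _]] _]]].
have -> : W = (fun x y => Wp x y - Wm x y) by apply/funext => x; apply/funext.
exact: P2_integrable2B.
Qed.

(** Positivity of [Wm] allows it to be dropped. With [H] the entropy, the bounded part of [Wp]
    contributes [4 * M * (H / 2)] and the quadratic part [L * (2 * H / rho)]. *)
Lemma pairing_diff_decomposable (g : geometry)
    (W : state_space R g d -> state_space R g d -> R) (M L rho : R)
    (nu m : probability (state_space R g d) R) :
  0 <= L -> 0 < rho -> decomposable W M L -> talagrand rho m ->
  P2 nu -> P2 m -> (entropy nu m < +oo)%E ->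
  pairing_diff W nu m <= 2 * (M + L / rho) * fine (entropy nu m).
Proof.
move=> L0 rho0 [Wp [Wm [WE [_ _ _ [iWp _]] [_ _ _ [iWm pWm]] bounds]]] tal.
move=> hnu hm fin.
have -> : W = (fun x y => Wp x y - Wm x y) by apply/funext => x; apply/funext.
rewrite pairing_diffB//.
suff : pairing_diff Wp nu m <= 2 * (M + L / rho) * fine (entropy nu m).
  by have := pWm _ _ hnu hm; lra.
have {}iWp : P2_integrable2 Wp by [].
move=> {W WE iWm pWm}; case: g Wp Wm nu m iWp bounds tal hnu hm fin.
  move=> Wp Wm nu m iWp [osc ->] _ hnu hm fin; rewrite mul0r addr0.
  have := pairing_diff_bounded iWp (Osc2_sum_bound osc) hnu hm fin.
  by congr (_ <= _); field.
move=> Wp Wm nu m iWp.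
move=> [Wpb [Wpq [Wmb [Wmq [WE [[mb _] _ _ _] [dq _] osc hess]]]]] tal hnu hm fin.
have WpE : recenter Wp = (fun x z => recenter Wpb x z + recenter Wpq x z).
  apply/funext => x; apply/funext => z; rewrite /recenter /second_difference.
  by rewrite !(WE _ _).1; ring.
have oscb := Osc2_sum_bound osc.
have ib := bounded_recenter_integrable mb oscb.
(* After recentring, the sum is integrable and the first part is bounded, hence the second is
   integrable too. *)
have iq : P2_integrable2 (recenter Wpq).
  have -> : recenter Wpq = (fun x z => recenter Wp x z - recenter Wpb x z).
    by rewrite WpE; apply/funext => x; apply/funext => z; rewrite addrC addKr.
  exact: P2_integrable2B (P2_integrable2_recenter iWp) ib.
rewrite -(pairing_diff_recenter iWp hnu hm) WpE pairing_diffD//.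
have b_le : pairing_diff (recenter Wpb) nu m <=
    4 * M * (fine (entropy nu m) / 2).
  apply: pairing_diff_bounded => // x y z w.
  by rewrite second_difference_recenter.
have q_le : pairing_diff (recenter Wpq) nu m <=
    L * (2 * fine (entropy nu m) / rho).
  apply: pairing_diff_quadratic => // x y z w.
  rewrite second_difference_recenter; apply: second_difference_le => //.
  apply: le_trans hess; apply: leeDl; exact: mixed_hessian_norm_ge0.
have := lerD b_le q_le; congr (_ <= _).
by field; rewrite gt_eqF.
Qed.

End decomposable_kernels.

(** * From the mean measure back to the individual ones *)

Theorem theorem8 (R : realType) (g : geometry) (d : nat) (hd : (0 < d)%N)
    (V : state_space R g d -> R) (W : state_space R g d -> state_space R g d -> R)
    (mstar : probability (state_space R g d) R)
    (hV : C2_fun V) (hW : C2_kernel W)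
    (hWsym : symmetric_kernel W) (hWgrowth : quadratic_growth W)
    (hPi : forall nu : probability (state_space R g d) R,
       P2 nu -> normalizable V W nu)
    (hm2 : P2 mstar) (hmstar : is_Pi V W mstar mstar)
    (MW LW rho delta : R) (N : nat)
    (hMW : 0 <= MW) (hLW : 0 <= LW) (hrho : 0 < rho)
    (hdelta : 0 < delta <= 1) (hN : (2 <= N)%N)
    (hdec : decomposable W MW LW)
    (htal : talagrand rho mstar)
    (hF : forall nu : probability (state_space R g d) R, P2 nu ->
       (delta%:E * entropy nu mstar <= free_energy W mstar nu)%E)
    (xi : 'I_N -> probability (state_space R g d) R)
    (hxi : forall i, P2 (xi i)) :
  let ellW := LW / rho in
  let deltaN := delta - (1 + MW + ellW) / (N%:R - 1) in
  (deltaN%:E * \sum_(i < N) entropy (xi i) mstar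
     <= free_energy_ind W mstar xi)%E.

Proof.
case: N hN xi hxi => // n n1 xi hxi; cbv zeta.
set ellW := LW / rho; set deltaN := delta - _.
set Ei := fun i => entropy (xi i) mstar.
have E0 i : (0 <= Ei i)%E by exact: entropy_ge0.
(* If some entropy is infinite, the right-hand side is [+oo], whatever the sign of [deltaN]. *)
have [/existsP[i /eqP Eoo]|/existsPn noo] := boolP [exists i, Ei i == +oo%E].
  have sumoo : (\sum_(i < n.+1) Ei i = +oo)%E.
    by rewrite (bigD1 i)//= Eoo addye// gt_eqF// (lt_le_trans ltNy0)// sume_ge0.
  by rewrite /free_energy_ind -/Ei sumoo addye// leey.
have fin i : (Ei i < +oo)%E by rewrite lt_neqAle noo leey.
pose S := \sum_(i < n.+1) fine (Ei i).
have sumS : (\sum_(i < n.+1) Ei i = S%:E)%E.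
  by rewrite -sumEFin; apply: eq_bigr => i _; rewrite fineK// ge0_fin_numE.
rewrite /free_energy_ind -/Ei sumS -EFinM -EFinD lee_fin.
have iW := decomposable_integrable hdec.
pose A i j := pairing (reduced W mstar) (xi i) (xi j).
have Aii i : A i i <= 2 * (MW + ellW) * fine (Ei i).
  rewrite /A pairing_reduced_diag//.
  exact: pairing_diff_decomposable hdec htal (hxi i) hm2 (fin i).
have S0 : 0 <= S by apply: sumr_ge0 => i _; rewrite fine_ge0.
(* Beyond [n], [inord] returns the default index 0, so every term of the sequence is one of the
   given measures and inherits their properties. *)
pose xin (k : nat) := xi (inord k).
have xinE (i : 'I_n.+1) : xin i = xi i by rewrite /xin inord_val.
have hxin k : P2 (xin k) by exact: hxi.
pose xibar : probability (state_space R g d) R := mixture n xin.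
have := hF xibar (P2_mixture n hxin).
have := @entropy_mixture R g d n xin mstar (fun k => fin (inord k)).
have -> : \sum_(i < n.+1) fine (entropy (xin i) mstar) = S.
  by apply: eq_bigr => i _; rewrite xinE.
rewrite -/xibar /free_energy.
rewrite (pairing_mixture n (P2_integrable2_reduced iW hm2) hxin).
have -> : \sum_(i < n.+1) \sum_(j < n.+1)
    pairing (reduced W mstar) (xin i) (xin j) = \sum_i A i i +
    \sum_(i < n.+1) \sum_(j < n.+1 | j != i) A i j.
  rewrite -big_split/=; apply: eq_bigr => i _; rewrite (bigD1 i)//= !xinE.
  by congr (_ + _); apply: eq_bigr => j _; rewrite xinE.
(* The entropy of the mean is a real [h]: it is nonnegative, and convexity bounds it by a real
   number. *)
have := entropy_ge0 xibar mstar; case: (entropy xibar mstar) => [h||]//.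
rewrite !lee_fin => h0 hS.
have : \sum_i A i i <= 2 * (MW + ellW) * S.
  by rewrite mulr_sumr; apply: ler_sum.
move: (\sum_i A i i) (\sum_i \sum_(j < n.+1 | j != i) _) => D T DS.
have [d0 d1] := andP hdelta.
have v0 : 0 < n%:R :> R by rewrite ltr0n -ltnS.
rewrite /deltaN; have nE : n.+1%:R = n%:R + 1 :> R by rewrite -natr1.
move: hS; rewrite nE addrK; move: (n%:R) v0 => v v0 hS hQ.
have w0 : 0 < v + 1 by lra.
have hS' : (v + 1) * h <= S by rewrite mulrC -ler_pdivlMr// mulrC.
(* The hypothesis at [xibar] reads [delta * h <= h + 2^-1 * ((v + 1)^-1 ^+ 2 * (D + T))], with
   [v + 1] the number of measures. The factor [1 - delta] is nonnegative, so [h] may be replaced by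
   its upper bound [S / (v + 1)]. *)
have lowT : - (2 * (v + 1) * (1 - delta) * S) <= D + T.
  have : (v + 1) * ((1 - delta) * ((v + 1) * h)) <= (v + 1) * ((1 - delta) * S).
    by rewrite ler_pM2l// ler_wpM2l//; lra.
  have : - ((1 - delta) * h) * (2 * (v + 1) ^+ 2) <= D + T.
    rewrite -ler_pdivlMr; last by rewrite mulr_gt0 ?exprn_gt0.
    rewrite (_ : (D + T) / _ = 2^-1 * ((v + 1)^-1 ^+ 2 * (D + T))); last first.
      by field; rewrite gt_eqF.
    lra.
  lra.
have dS : 0 <= delta * S by rewrite mulr_ge0// ltW.
have v20 : 0 < 2 * v by lra.
(* Subtracting [DS] from [lowT] bounds [T] below. The 1 in [1 + MW + ellW] pays for having [v + 1]
   in [lowT] against [v] here, and [2 * (delta * S)] is left over, nonnegative by [dS]. *)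
rewrite -(ler_pM2l v20).
have -> : 2 * v * ((delta - (1 + MW + ellW) / v) * S) =
    2 * v * delta * S - 2 * (1 + MW + ellW) * S by field; rewrite gt_eqF.
have -> : 2 * v * (S + (2 * v)^-1 * T) = 2 * v * S + T.
  by field; rewrite gt_eqF.
lra.
Qed.
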